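(* The treewidth of the triangulation flip graph $F_n$ on the $n\times n$ integer lattice point set is $\Omega(N^{1-o(1)})$, where $N=|V(F_n)|$ and the asymptotics are as $n\to\infty$.
   Context: The $n\times n$ integer lattice point set is $\{(i,j): 1\le i,j\le n\}\subset\mathbb{Z}^2$. A triangulation of a finite planar point set is a maximal set of pairwise non-crossing straight edges connecting pairs of points of the set (an edge does not pass through other points of the set). The integer lattice triangulation flip graph $F_n$ has as vertices all triangulations of the $n\times n$ integer lattice point set, and its edges are the pairs of triangulations that differ by exactly one edge (a flip of one diagonal). Treewidth is the standard graph parameter. *)

(* Defs.v *)
From HB Require Import structures.
From mathcomp Require Import all_boot all_order all_algebra.
From mathcomp Require Import all_classical all_reals all_analysis.

Set Implicit Arguments.
Unset Strict Implicit.
Unset Printing Implicit Defensive.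

Import Order.TTheory GRing.Theory Num.Theory.
Import numFieldNormedType.Exports.

Local Open Scope classical_set_scope.
Local Open Scope ring_scope.

(** * Treewidth of a finite graph, given by its adjacency relation *)

Definition is_tree (I : finType) (t : rel I) : Prop :=
  [/\ (0 < #|I|)%N, symmetric t, irreflexive t,
      forall i j, connect t i j
    & forall c : seq I, (2 < size c)%N -> ~~ (cycle t c && uniq c)].

Definition tree_decomposition (V : finType) (adj : rel V)
    (I : finType) (t : rel I) (bag : I -> {set V}) : Prop :=
  [/\ is_tree t,
      forall v, exists i, v \in bag i,
      forall u v, adj u v -> exists i, (u \in bag i) && (v \in bag i)
    & forall v i j, v \in bag i -> v \in bag j ->
        connect [rel a b | [&& t a b, v \in bag a & v \in bag b]] i j].

(* For the graph without vertices this gives 0 instead of -1. *)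
Definition decomposition_width (V I : finType) (bag : I -> {set V}) : nat :=
  (\max_(i : I) #|bag i|)%N.-1.

Definition has_decomposition_of_width (V : finType) (adj : rel V) : pred nat :=
  fun k => `[< exists (I : finType) (t : rel I) (bag : I -> {set V}),
                 tree_decomposition adj t bag /\ decomposition_width bag = k >].

Lemma ex_decomposition (V : finType) (adj : rel V) :
  exists k, has_decomposition_of_width adj k.
Proof.
exists #|V|.-1; apply/asboolP; exists unit, (fun _ _ => false), (fun=> [set: V]%SET).
split; last by rewrite /decomposition_width (big_pred1 tt) ?cardsT // => -[].
split.
- split=> //; first by rewrite card_unit.
    by move=> [] []; exact: connect0.
  by case=> [|[] [|[] c]].
- by move=> v; exists tt; rewrite inE.
- by move=> u v _; exists tt; rewrite !inE.
- by move=> v [] [] _ _; exact: connect0.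
Qed.

Definition treewidth (V : finType) (adj : rel V) : nat :=
  ex_minn (ex_decomposition adj).

(** * Triangulations of a finite planar point set and their flip graph *)

Definition open_segment (R : realType) (a b : R * R) : set (R * R) :=
  [set x | exists2 s : R, 0 < s < 1 &
     x = ((1 - s) * a.1 + s * b.1, (1 - s) * a.2 + s * b.2)].

(* The points are indexed by a finite type [T] through [pos : T -> R * R],
   assumed injective; an edge is the two-element set of (indices of) its
   endpoints. *)
Section PointSet.
Variables (R : realType) (T : finType) (pos : T -> R * R).

Definition edge_interior (e : {set T}) : set (R * R) :=
  [set x | exists p q : T,
     e = [set p; q]%SET /\ open_segment (pos p) (pos q) x].

Definition straight_edge (e : {set T}) : bool :=
  (#|e| == 2%N) && `[< forall r : T, ~ edge_interior e (pos r) >].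

(* As straight edges contain no points of the set besides their endpoints, two
   distinct ones can only meet in a common endpoint or in their interiors. *)
Definition crossing (e f : {set T}) : bool :=
  (e != f) && `[< edge_interior e `&` edge_interior f !=set0 >].

Definition noncrossing (A : {set {set T}}) : bool :=
  [forall e in A, straight_edge e] &&
  [forall e in A, forall f in A, ~~ crossing e f].

Definition triangulation : finType :=
  {A : {set {set T}} | maxset noncrossing A}.

Definition flip (A B : triangulation) : bool :=
  (#|val A :\: val B| == 1%N) && (#|val B :\: val A| == 1%N).

End PointSet.

(* Ordinals start from 0, hence the successors: coordinates range over 1..n. *)
Definition lattice_pos (R : realType) (n : nat) (p : 'I_n * 'I_n) : R * R :=
  ((p.1.+1)%:R, (p.2.+1)%:R).

Definition lattice_triangulation (R : realType) (n : nat) : finType :=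
  triangulation (@lattice_pos R n).

Definition lattice_flip (R : realType) (n : nat) :
    rel (lattice_triangulation R n) :=
  @flip R _ (@lattice_pos R n).

(* Main.v *)
Require Import Defs.
From HB Require Import structures.
From mathcomp Require Import all_boot all_order all_algebra.
From mathcomp Require Import all_classical all_reals all_analysis.
From mathcomp Require Import fintype finset zify ring lra.

(** The square is cut into blocks of a fixed size [m], and the edges of the standard
    triangulation (unit edges and diagonals of direction [(1, 1)]) are kept
    between the blocks.  Triangulating the blocks independently embeds a Cartesian
    power of the flip graph of a block into the flip graph of the square
    ([glue_hom], [glue_tri_inj]), so treewidth can be bounded below in the power.

    Treewidth of a power ([treewidth_power]).  Let [G] be connected with [M]
    vertices.  Some bag of any tree decomposition is a balanced separator
    ([balanced_bag]), and so it meets the canonical paths, which change one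
    coordinate after the other, of half of all pairs of vertices of the [k]-th
    power.  A vertex is on at most [k * M ^ k.+1] of these paths, which gives
    a treewidth of order [M ^ k / (k * M)].

    Connectivity ([lattice_flip_connected]).  A longest edge of a triangulation
    that is not standard is a diagonal of a unimodular parallelogram inside its
    bounding box.  An edge that crossed a side of this parallelogram without
    crossing the diagonal would be longer ([side_free]); hence the four sides
    belong to the triangulation and the diagonal can be flipped.  The other
    diagonal is shorter, or it turns an antidiagonal of a unit square into a
    standard edge ([shortening_flip]).  So every triangulation reaches the standard
    one.  Since flips preserve the midpoint of the edge, all triangulations have
    the same number of edges and the same midpoints, namely the half-integral
    points of the square that are not integral.

    Counting ([card_triangulations_le]).  Edges are revealed in the lexicographic
    order of their midpoints.  Suppose that three different edges with the same
    midpoint [x] are compatible with the edges revealed before.  Of any two points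
    symmetric about [x] one comes before [x], so for each pair of candidates every
    midpoint near [x] carries, up to symmetry about [x], an edge that crosses
    neither.  A descent on these edges ([odd_vectors_at_corners]) shows that the
    vectors of the two candidates generate those of all candidates; for three
    candidates this contradicts their congruence modulo 2
    ([no_three_candidates]).  So there are at most two choices at each midpoint,
    and the number [N n] of triangulations is at most [2 ^ (4 * n ^ 2)].

    Conclusion ([entropy_lower_bound]).  Hence [ln (N n) / n ^ 2] has a finite
    supremum.  If [m] almost attains it, then [(n / m) ^ 2] blocks of size [m]
    have together almost the entropy of the whole square, and the loss of a
    factor [k * M], with [M = N m] fixed, is negligible. *)

Set Implicit Arguments.
Unset Strict Implicit.
Unset Printing Implicit Defensive.

Import Order.TTheory GRing.Theory Num.Theory.
Import numFieldNormedType.Exports.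

Local Open Scope ring_scope.

(** * Treewidth and balanced separators *)

Definition avoiding (I : eqType) (t : rel I) (j : I) : rel I :=
  [rel a b | [&& t a b, a != j & b != j]].

Lemma avoiding_sym (I : finType) (t : rel I) (j : I) :
  symmetric t -> connect_sym (avoiding t j).
Proof.
move=> ts; apply: sym_connect_sym => a b /=.
by rewrite /avoiding /= ts (andbC (a != j)).
Qed.

Lemma connect_last_step (I : finType) (e : rel I) (i j : I) :
  i != j -> connect e i j -> exists2 y, e y j & connect (avoiding e j) i y.
Proof.
move=> ij /connectP[p0 pp0 ej]; subst j.
case/shortenP: pp0 ij => p pp up _ ij.
case/lastP: p pp up ij => [|p x]; first by rewrite eqxx.
rewrite last_rcons rcons_path => /andP[pp ex] up ij.
exists (last i p) => //.
apply/connectP; exists p => //.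
move: up; rewrite -rcons_cons rcons_uniq => /andP[xp _].
elim: p i pp xp {ex ij} => //= y p IH i /andP[eiy pp].
rewrite !inE !negb_or => /and3P[xi xy xp].
rewrite {1}/avoiding /= eiy eq_sym xi eq_sym xy /=; apply: IH => //.
by rewrite inE negb_or xy.
Qed.

(** A path from [x] to [y] off [j] would close up, through [j], to a cycle. *)
Lemma tree_neighbour_unique (I : finType) (t : rel I) (j x y : I) :
  is_tree t -> t j x -> t j y -> connect (avoiding t j) x y -> x = y.
Proof.
case=> _ ts ti _ tc jx jy /connectP[p0 pp0 ey].
apply: contraTeq isT => xy; rewrite ey in jy xy.
case/shortenP: pp0 jy xy => p pp up _ jy xy.
have xj : x != j by apply: contraTneq jx => ->; rewrite ti.
have [pt jp] : path t x p /\ j \notin p.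
  elim: p x pp xj {up jy xy jx ey} => //= z p IH x /andP[/and3P[txz _ zj] pp] _.
  have [-> jp] := IH z pp zj; rewrite txz inE negb_or jp eq_sym zj.
  by split.
have sz : (2 < size [:: j, x & p])%N by case: p xy {pp up jy pt jp} => //; rewrite eqxx.
have ujxp : uniq [:: j, x & p] by rewrite cons_uniq inE negb_or jp eq_sym xj up.
by have := tc _ sz; rewrite ujxp andbT /= jx rcons_path pt ts jy.
Qed.

(** Call a component of the tree minus a node heavy if more than half of the
    vertices have all their bags inside it.  If every node had a heavy
    component, take a smallest one, cut off at [j], and move from [j] to its
    neighbour in it: two heavy components meet, so the heavy component at the
    neighbour cannot contain [j] and is strictly smaller.  Hence some bag has
    only light components; [cls] names the component of a vertex. *)
Lemma balanced_bag (V : finType) (adj : rel V) (I : finType) (t : rel I)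
    (bag : I -> {set V}) :
  tree_decomposition adj t bag ->
  exists (j : I) (cls : V -> I),
    (forall u v, u \notin bag j -> v \notin bag j -> adj u v -> cls u = cls v) /\
    (forall r, (2 * #|[set v | (v \notin bag j) && (cls v == r)]| <= #|V|)%N).
Proof.
case=> [tree cov edges conn]; have [I0 ts ti tcon _] := tree.
have /fin_all_exists[node nodeP] : forall v, exists i, v \in bag i by [].
pose cls j v := fingraph.root (avoiding t j) (node v).
pose part j r := [set v | (v \notin bag j) && (cls j v == r)].
have csym j := avoiding_sym j ts.
have bag_comp j v i i' : v \notin bag j -> v \in bag i -> v \in bag i' ->
    connect (avoiding t j) i i'.
  move=> vj vi vi'; have := conn v _ _ vi vi'.
  apply: connect_sub => a b /and3P[tab va vb]; apply: connect1.
  rewrite /avoiding /= tab /=; apply/andP; split; apply: contraNneq vj => <-; assumption.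
have cls_adj j u v : u \notin bag j -> v \notin bag j -> adj u v ->
    cls j u = cls j v.
  move=> uj vj /edges[i /andP[ui vi]]; apply/eqP; rewrite root_connect //.
  exact: connect_trans (bag_comp _ _ _ _ uj (nodeP u) ui) (bag_comp _ _ _ _ vj vi (nodeP v)).
have [|] := pselect (exists j, forall r, (2 * #|part j r| <= #|V|)%N).
  by case=> j jP; exists j, (cls j); split => // u v; exact: cls_adj.
move=> /forallNP noj; exfalso.
pose heavy (jr : I * I) := (#|V| < 2 * #|part jr.1 jr.2|)%N.
pose comp (jr : I * I) := [set i | connect (avoiding t jr.1) jr.2 i].
have exheavy j : exists r, heavy (j, r).
  by have /existsNP[r /negP] := noj j; rewrite -ltnNge => ?; exists r.
have [j0 _] := card_gt0P I0.
have [r0 hr0] := exheavy j0.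
case: (arg_minnP (fun jr => #|comp jr|) hr0) => -[j r] hjr minjr.
have in_part j' r' v : v \in part j' r' ->
    [/\ v \notin bag j', node v != j' & connect (avoiding t j') r' (node v)].
  rewrite inE => /andP[vj /eqP <-]; split=> //.
    by apply: contraNneq vj => <-.
  by rewrite csym connect_root.
have meet A B : heavy A -> heavy B -> exists2 v, v \in part A.1 A.2 & v \in part B.1 B.2.
  move=> hA hB; have [/eqP|/set0Pn[v]] := boolP (part A.1 A.2 :&: part B.1 B.2 == set0)%SET; last first.
    by rewrite inE => /andP[vA vB]; exists v.
  move=> e0; have := cardsUI (part A.1 A.2) (part B.1 B.2).
  rewrite e0 cards0 addn0 => eq; have := max_card (mem (part A.1 A.2 :|: part B.1 B.2)%SET).
  move: hA hB; rewrite /heavy eq; lia.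
have [v vjr _] := meet _ _ hjr hjr.
have [vj nvj rv] := in_part _ _ _ vjr.
have [y yj ry] : exists2 y, t y j & connect (avoiding t j) (node v) y.
  exact: connect_last_step nvj (tcon _ _).
have [r' hr'] := exheavy y.
have ty : y != j by apply: contraTneq yj => ->; rewrite ti.
(* Otherwise [y] would be joined off [j] to another neighbour of [j]. *)
have [w wjr wyr'] := meet _ _ hjr hr'.
have [wj nwj rw] := in_part _ _ _ wjr.
have [wy nwy r'w] := in_part _ _ _ wyr'.
have r'j : ~~ connect (avoiding t y) (node w) j.
  apply/negP => wcj; have [z /and3P[tzj zy _] wz] := connect_last_step nwj wcj.
  case/negP: zy; apply/eqP.
  apply: (tree_neighbour_unique tree (j := j)); rewrite 1?ts //.
  have: connect (avoiding t j) (node w) z.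
    apply: connect_sub wz => a b /and3P[/and3P[tab _ _] aj bj].
    by apply: connect1; rewrite /avoiding /= tab aj.
  rewrite csym => wz'; apply: connect_trans wz' _.
  apply: connect_trans ry; rewrite csym.
  by apply: connect_trans rw; rewrite csym.
have /minjr : heavy (y, r') by [].
rewrite leqNgt => /negP[]; apply: proper_card; apply/properP; split.
  apply/subsetP => i; rewrite !inE /= => r'i.
  have wi : connect (avoiding t y) (node w) i.
    by rewrite (connect_trans _ r'i) // csym.
  apply: connect_trans rw _.
  case/connectP: wi => p pp ->.
  elim: p (node w) nwj r'j pp => [|x p IH] b bj b'j /=; first by rewrite connect0.
  case/andP=> tbx pp.
  have bx : connect (avoiding t y) b x by apply: connect1.
  have xj : x != j by apply: contraNneq b'j => <-.
  apply: connect_trans (IH x xj _ pp).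
    by apply: connect1; case/and3P: tbx => tbx _ _; rewrite /avoiding /= tbx bj.
  by apply: contraNN b'j; apply: connect_trans.
exists y; rewrite !inE /=; first exact: connect_trans rv ry.
apply/negP; rewrite csym => yr'.
have /(connect_last_step _) : connect (avoiding t y) (node w) y.
  by rewrite csym (connect_trans yr').
by case/(_ nwy) => z /and3P[_ _]; rewrite eqxx.
Qed.

Lemma treewidth_decomposition (V : finType) (adj : rel V) :
  exists (I : finType) (t : rel I) (bag : I -> {set V}),
    tree_decomposition adj t bag /\ decomposition_width bag = treewidth adj.
Proof. by rewrite /treewidth; case: ex_minnP => k /asboolP. Qed.

(** The preimages of the bags of a decomposition form a decomposition; by
    injectivity they are not larger. *)
Lemma treewidth_hom (U V : finType) (adj : rel U) (adj' : rel V) (f : U -> V) :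
    injective f -> (forall u v, adj u v -> adj' (f u) (f v)) ->
  (treewidth adj <= treewidth adj')%N.
Proof.
move=> finj fhom; have [I [t [bag [[tree cov edges conn] <-]]]] := treewidth_decomposition adj'.
pose bag' i := (f @^-1: bag i)%SET.
apply: (@leq_trans (decomposition_width bag')).
  rewrite {1}/treewidth; case: ex_minnP => k _; apply; apply/asboolP.
  exists I, t, bag'; split=> //; split=> //.
  - by move=> v; have [i vi] := cov (f v); exists i; rewrite inE.
  - by move=> u v /fhom/edges[i uv]; exists i; rewrite !inE.
  - move=> v i j; rewrite !inE => vi vj.
    have := conn (f v) i j vi vj; apply: connect_sub => a b /= ab.
    by apply: connect1; rewrite /= !inE.
rewrite /decomposition_width -!subn1 leq_sub2r //.
apply/bigmax_leqP => i _; apply: leq_trans (leq_bigmax i).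
by rewrite -(card_imset _ finj) subset_leq_card //; apply/subsetP => _ /imsetP[u + ->]; rewrite inE.
Qed.

(** * Treewidth of Cartesian powers *)

Section CartesianPower.
Variables (G : finType) (g : rel G) (k : nat).

Definition power_adj : rel {ffun 'I_k -> G} :=
  fun u v => [exists i, g (u i) (v i) && [forall j, (j != i) ==> (u j == v j)]].

(** The canonical path from [u] to [v] changes the coordinates from those of
    [u] to those of [v] one by one, in increasing order.  The set below contains
    the pairs whose path can go through [w] while coordinate [i] is changing:
    then the coordinates before [i] are final and those after [i] initial.
    Such a pair is determined by the coordinates of [u] up to [i] and those of
    [v] from [i] on, which are free. *)
Lemma card_meeting_pairs (w : {ffun 'I_k -> G}) (i : 'I_k) :
  (#|[set uv : {ffun 'I_k -> G} * {ffun 'I_k -> G} |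
      [forall j : 'I_k, ((j < i) ==> (uv.2 j == w j)) && ((i < j) ==> (uv.1 j == w j))]]|
   <= #|G| ^ k * #|G|)%N.
Proof.
pose f (uv : {ffun 'I_k -> G} * {ffun 'I_k -> G}) :=
  ([ffun j : 'I_k => if (j <= i)%N then uv.1 j else uv.2 j], uv.2 i).
apply: (@leq_trans #|{: {ffun 'I_k -> G} * G}|); last first.
  by rewrite card_prod card_ffun card_ord.
rewrite -(card_in_imset (f := f)) ?max_card // => -[u v] [u' v'].
rewrite !inE /= => /forallP uvP /forallP uvP' [/ffunP e1 e2].
congr (_, _); apply/ffunP => j; have /andP[] := uvP j; have /andP[] := uvP' j;
  have := e1 j; rewrite !ffunE; case: (ltngtP j i) => [ij|ij|/val_inj ->] //= eij.
    by move=> _ /eqP-> _ /eqP->.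
  by move=> /eqP-> _ /eqP->.
Qed.

(** A class function that is constant along edges off [S] agrees at the ends of
    every canonical path off [S]. *)
Lemma power_adj_connect_invariant (C : Type) (cls : {ffun 'I_k -> G} -> C)
    (S : {set {ffun 'I_k -> G}}) (u v : {ffun 'I_k -> G}) :
    (forall x y, connect g x y) ->
    (forall a b, a \notin S -> b \notin S -> power_adj a b -> cls a = cls b) ->
    (forall (i : 'I_k) w, w \in S ->
      ~~ [forall j : 'I_k, ((j < i)%N ==> (v j == w j)) && ((i < j)%N ==> (u j == w j))]) ->
  cls u = cls v.
Proof.
move=> gcon clsP avoid.
pose mix i (x : G) := [ffun j : 'I_k => if (j < i)%N then v j else if (j == i :> nat) then x else u j].
have mixS (i : 'I_k) x : mix i x \notin S.
  apply/negP => /avoid => /(_ i)/negP[]; apply/forallP => j; rewrite !ffunE.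
  by case: (ltngtP j i) => _; rewrite ?eqxx.
have step (i : 'I_k) : cls (mix i (u i)) = cls (mix i (v i)).
  have /connectP[p] := gcon (u i) (v i).
  elim: p (u i) => [x _ -> //|y p IH x] /= /andP[gxy pp] ey.
  rewrite -(IH y pp ey); apply: clsP => //.
  apply/existsP; exists i; rewrite !ffunE ltnn eqxx gxy /=.
  by apply/forallP => j; apply/implyP => ji; rewrite !ffunE -[j == i :> nat]/(j == i) (negPf ji).
pose pre i := [ffun j : 'I_k => if (j < i)%N then v j else u j].
have preP i : (i <= k)%N -> cls (pre i) = cls u.
  elim: i => [_|i IH ik]; first by congr cls; apply/ffunP => j; rewrite ffunE.
  rewrite -(IH (ltnW ik)) -[i]/(nat_of_ord (Ordinal ik)); set io := Ordinal ik.
  transitivity (cls (mix io (v io))).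
    congr cls; apply/ffunP => j; rewrite !ffunE ltnS.
    by case: (ltngtP j io) => // /val_inj ->.
  rewrite -step; congr cls; apply/ffunP => j; rewrite !ffunE.
  by case: (ltngtP j io) => // /val_inj ->.
by rewrite -(preP k (leqnn k)); congr cls; apply/ffunP => j; rewrite ffunE ltn_ord.
Qed.

(** A bag that leaves at most half of the vertices in each class meets the
    canonical paths of at least half of all pairs, since at most half of the
    pairs lie in a common class.  A vertex is on at most [k * #|G| ^ k.+1]
    canonical paths, so the bag cannot be small. *)
Theorem treewidth_power :
    (0 < k)%N -> (forall x y, connect g x y) ->
  (#|G| ^ k <= 2 * k * #|G| * (treewidth power_adj).+1)%N.
Proof.
move=> k0 gcon; pose V : finType := {ffun 'I_k -> G}.
have [I [t [bag [tdec width]]]] := treewidth_decomposition power_adj.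
have [j [cls [clsP half]]] := balanced_bag tdec.
set S := bag j in clsP half.
have Sw : (#|S| <= (treewidth power_adj).+1)%N.
  by rewrite -width; apply: leq_trans (leqSpred _); apply: leq_bigmax.
pose block (wi : V * 'I_k) := [set uv : V * V |
  [forall j : 'I_k, ((j < wi.2)%N ==> (uv.2 j == wi.1 j)) && ((wi.2 < j)%N ==> (uv.1 j == wi.1 j))]].
pose same := [set uv : V * V | [&& uv.1 \notin S, uv.2 \notin S & cls uv.2 == cls uv.1]].
pose met := \bigcup_(wi in setX S [set: 'I_k]) block wi.
have cover : [set: V * V] \subset same :|: met.
  apply/subsetP => -[u v] _; rewrite inE.
  have [//|nb] := boolP ((u, v) \in met); first by rewrite orbT.
  have avoid (i : 'I_k) w : w \in S -> (u, v) \notin block (w, i).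
    by move=> wS; apply: contraNN nb => b; apply/bigcupP; exists (w, i) => //; rewrite inE /= wS inE.
  have uS : u \notin S.
    apply/negP => /(avoid (Ordinal k0)); rewrite inE => /forallP[] i /=.
    by rewrite eqxx implybT.
  have vS : v \notin S.
    have k1 : (k.-1 < k)%N by rewrite prednK.
    apply/negP => /(avoid (Ordinal k1)); rewrite inE => /forallP[] i /=.
    by rewrite eqxx implybT /= ltnNge -ltnS prednK // ltn_ord.
  rewrite orbF inE /= uS vS /=; apply/eqP; apply: esym.
  apply: (power_adj_connect_invariant gcon clsP) => i w wS.
  by have := avoid i w wS; rewrite inE.
have cardV : #|{: V}| = (#|G| ^ k)%N by rewrite card_ffun card_ord.
have le1 : (2 * #|same| <= (#|G| ^ k) * (#|G| ^ k))%N.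
  rewrite -sum1_card (partition_big (fun uv => uv.1) predT) //= big_distrr /=.
  rewrite -{1}cardV -sum_nat_const; apply: leq_sum => u _.
  rewrite -cardV; apply: leq_trans (half (cls u)); rewrite leq_mul2l /= sum1dep_card.
  rewrite -(card_in_imset (f := fun uv : V * V => uv.2)).
    apply/subset_leq_card/subsetP => _ /imsetP[[u' v'] + ->].
    by rewrite !inE /= => /andP[/and3P[_ -> /eqP->] /eqP->]; rewrite eqxx.
  by move=> [a b] [a' b'] /=; rewrite !inE /= => /andP[_ /eqP->] /andP[_ /eqP->] ->.
have le2 : (#|met| <= #|S| * k * (#|G| ^ k * #|G|))%N.
  apply: (@leq_trans (\sum_(wi in setX S [set: 'I_k]) #|block wi|)).
    rewrite /met; elim/big_ind2: _ => [|A a B b Aa Bb|//]; first by rewrite cards0.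
    exact: leq_trans (leq_card_setU _ _).1 (leq_add Aa Bb).
  have -> : (#|S| * k = #|setX S [set: 'I_k]|)%N by rewrite cardsX cardsT card_ord.
  by rewrite -sum_nat_const; apply: leq_sum => -[w i] _; apply: card_meeting_pairs.
have := subset_leq_card cover; rewrite cardsT card_prod cardV => le0.
have le3 := leq_trans le0 (leq_card_setU _ _).1.
have [->//|G0] := posnP (#|G| ^ k)%N.
rewrite -(leq_pmul2l G0).
move: le1 le2 le3; set N := (#|G| ^ k)%N; set m := #|met|; set s := #|same| => le1 le2 le3.
have le4 : (N * N <= 2 * (#|S| * k * (N * #|G|)))%N by lia.
apply: leq_trans le4 _.
have -> : (2 * (#|S| * k * (N * #|G|)) = N * (2 * k * #|G| * #|S|))%N by ring.
by rewrite !leq_mul2l Sw !orbT.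
Qed.
End CartesianPower.

(** * Segments in affine coordinates *)

Section PlaneGeometry.
Variable R : realType.
Implicit Types (a b c d x o e w : R * R).

Definition det e w : R := e.1 * w.2 - e.2 * w.1.

Definition meet a b c d : Prop := (open_segment a b `&` open_segment c d !=set0)%classic.

Definition frame o e w x : R * R :=
  (o.1 + x.1 * e.1 + x.2 * w.1, o.2 + x.1 * e.2 + x.2 * w.2).

Lemma open_segmentC a b : open_segment a b = open_segment b a.
Proof.
apply/predeqP => x; split=> -[s s01 ->]; exists (1 - s) => //; first by lra.
  by congr (_, _); ring.
  lra.
by congr (_, _); ring.
Qed.

Lemma meet_swapl a b c d : meet a b c d <-> meet b a c d.
Proof. by rewrite /meet open_segmentC. Qed.

Lemma meet_swapr a b c d : meet a b c d <-> meet a b d c.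
Proof. by rewrite /meet (open_segmentC c). Qed.

Lemma open_segment_frame o e w a b x : det e w != 0 ->
  open_segment (frame o e w a) (frame o e w b) (frame o e w x) <-> open_segment a b x.
Proof.
move=> det0; split=> -[s s01 ex]; exists s => //; last first.
  by rewrite ex /frame /=; congr (_, _); ring.
case: ex; rewrite /= => e1 e2.
have h1 : det e w * x.1 = det e w * ((1 - s) * a.1 + s * b.1).
  have -> : det e w * x.1 = (o.1 + x.1 * e.1 + x.2 * w.1 - o.1) * w.2
      - (o.2 + x.1 * e.2 + x.2 * w.2 - o.2) * w.1 by rewrite /det; ring.
  by rewrite e1 e2 /det; ring.
have h2 : det e w * x.2 = det e w * ((1 - s) * a.2 + s * b.2).
  have -> : det e w * x.2 = (o.2 + x.1 * e.2 + x.2 * w.2 - o.2) * e.1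
      - (o.1 + x.1 * e.1 + x.2 * w.1 - o.1) * e.2 by rewrite /det; ring.
  by rewrite e1 e2 /det; ring.
by rewrite [LHS]surjective_pairing (mulfI det0 h1) (mulfI det0 h2).
Qed.

Lemma frame_surj o e w y : det e w != 0 -> exists x, y = frame o e w x.
Proof.
move=> det0; exists (det (y.1 - o.1, y.2 - o.2) w / det e w, det e (y.1 - o.1, y.2 - o.2) / det e w).
rewrite /frame [LHS]surjective_pairing /=; congr (_, _); move: det0; rewrite /det /= => det0; field => //.
Qed.

(** All incidences below are computed after such a change of coordinates, which
    turns the relevant triangle or parallelogram into a standard one. *)
Lemma meet_frame o e w a b c d : det e w != 0 ->
  meet (frame o e w a) (frame o e w b) (frame o e w c) (frame o e w d) <-> meet a b c d.
Proof.
move=> det0; split=> -[y [ya yc]].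
  have [x ex] := frame_surj o y det0; rewrite {}ex in ya yc.
  by exists x; split; [move: ya | move: yc]; rewrite open_segment_frame.
by exists (frame o e w y); split; rewrite open_segment_frame.
Qed.

(** The four cases are images of one another under the symmetries of the square.
    In the case [1 < p], the segment crosses the line of abscissa 1 either on the
    square or after having left it through a horizontal side. *)
Lemma unit_square_exit (x y p q : R) : 0 < x < 1 -> 0 < y < 1 ->
    [|| 1 < p, p < 0, 1 < q | q < 0] ->
  exists t X Y : R, [/\ 0 < t < 1, X = (1 - t) * x + t * p, Y = (1 - t) * y + t * q
    & ((X == 0) || (X == 1)) && (0 <= Y <= 1) || ((Y == 0) || (Y == 1)) && (0 <= X <= 1)].
Proof.
have main (x' y' p' q' : R) : 0 < x' < 1 -> 0 < y' < 1 -> 1 < p' ->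
  exists t X Y : R, [/\ 0 < t < 1, X = (1 - t) * x' + t * p', Y = (1 - t) * y' + t * q'
    & ((X == 0) || (X == 1)) && (0 <= Y <= 1) || ((Y == 0) || (Y == 1)) && (0 <= X <= 1)].
  move=> x01 y01 p1.
  pose t := (1 - x') / (p' - x').
  have pos : p' - x' > 0 by lra.
  have tE : t * (p' - x') = 1 - x' by rewrite /t; field; lra.
  have t01 : 0 < t < 1 by apply/andP; split; nra.
  pose Y := (1 - t) * y' + t * q'.
  have [Y01|] := boolP (0 <= Y <= 1).
    by exists t, 1, Y; split => //; [lra | rewrite eqxx orbT Y01].
  have exitY (z : R) : z - y' != 0 -> 0 < (z - y') / (Y - y') < 1 -> (z == 0) || (z == 1) ->
    Y - y' != 0 ->
  exists t X Y : R, [/\ 0 < t < 1, X = (1 - t) * x' + t * p', Y = (1 - t) * y' + t * q'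
    & ((X == 0) || (X == 1)) && (0 <= Y <= 1) || ((Y == 0) || (Y == 1)) && (0 <= X <= 1)].
    move=> z0; set l := _ / _ => l01 zP Yy.
    have lE : l * (Y - y') = z - y' by rewrite /l; field.
    have X01 : 0 <= (1 - l * t) * x' + l * t * p' <= 1 by apply/andP; split; nra.
    exists (l * t), ((1 - l * t) * x' + l * t * p'), z; split => //.
    - by apply/andP; split; nra.
    - by rewrite /Y in lE; nra.
    - by rewrite zP X01 orbT.
  rewrite negb_and -!ltNge => /orP[Y0|Y1].
    apply: (exitY 0); rewrite ?eqxx //; try (by lra).
    have -> : (0 - y') / (Y - y') = y' / (y' - Y) by field; lra.
    by rewrite divr_gt0 ?ltr_pdivrMr; lra.
  apply: (exitY 1); rewrite ?eqxx ?orbT //; try (by lra).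
  by rewrite divr_gt0 ?ltr_pdivrMr; lra.
move=> x01 y01 /or4P[p1|p0|q1|q0].
- exact: main.
- have [h1 h2] : 0 < 1 - x < 1 /\ 1 < 1 - p by split; lra.
  have [t [X [Y [t01 eX eY bd]]]] := main _ _ _ q h1 y01 h2.
  exists t, (1 - X), Y; split => //; first lra.
  by move: bd => /orP[/andP[/orP[/eqP->|/eqP->] b]|/andP[b1 b2]]; apply/orP; [left|left|right];
    rewrite ?b ?b1 ?subr0 ?subrr ?eqxx ?orbT //=; lra.
- have [t [X [Y [t01 eX eY bd]]]] := main _ _ _ p y01 x01 q1.
  by exists t, Y, X; split => //; rewrite orbC.
- have [h1 h2] : 0 < 1 - y < 1 /\ 1 < 1 - q by split; lra.
  have [t [X [Y [t01 eX eY bd]]]] := main _ _ _ p h1 x01 h2.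
  exists t, Y, (1 - X); split => //; first lra.
  by move: bd => /orP[/andP[/orP[/eqP->|/eqP->] b]|/andP[b1 b2]]; apply/orP; [right|right|left];
    rewrite ?b ?b1 ?subr0 ?subrr ?eqxx ?orbT //=; lra.
Qed.
End PlaneGeometry.

(** * Lattice segments that cross a unimodular triangle or parallelogram *)

Section LatticeGeometry.
Variable R : realType.

Definition ipt (i j : int) : R * R := (i%:~R, j%:~R).

(** A segment from inside the unit square that avoids its open sides and its
    corners can only end at corners, and two corners whose segment meets the
    interior are opposite. *)
Lemma unit_square_diagonal (u1 u2 v1 v2 : int) (x : R * R) :
    let u := ipt u1 u2 in let v := ipt v1 v2 in
    0 < x.1 < 1 -> 0 < x.2 < 1 -> open_segment u v x ->
    ~ meet u v (ipt 0 0) (ipt 1 0) -> ~ meet u v (ipt 0 0) (ipt 0 1) ->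
    ~ meet u v (ipt 1 0) (ipt 1 1) -> ~ meet u v (ipt 0 1) (ipt 1 1) ->
    (forall i j : int, 0 <= i <= 1 -> 0 <= j <= 1 -> ~ open_segment u v (ipt i j)) ->
  [/\ u1 + v1 = 1, u2 + v2 = 1, 0 <= u1 <= 1 & 0 <= u2 <= 1].
Proof.
move=> u v x1 x2 ux s1 s2 s3 s4 corner.
(* An endpoint outside the square would make the segment cross its boundary. *)
have inside (w1 w2 : int) :
    (forall t : R, 0 < t < 1 ->
       open_segment u v ((1 - t) * x.1 + t * w1%:~R, (1 - t) * x.2 + t * w2%:~R)) ->
    (0 <= w1 <= 1) && (0 <= w2 <= 1).
  move=> onseg; have [//|out] := boolP (_ && _); exfalso.
  have : [|| (1 : R) < w1%:~R, w1%:~R < (0 : R), (1 : R) < w2%:~R | w2%:~R < (0 : R)].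
    by rewrite (ltr_int R 1) (ltr_int R _ 0) (ltr_int R 1) (ltr_int R _ 0); move: out; lia.
  move=> /(unit_square_exit x1 x2) [t [X [Y [t01 eX eY bd]]]].
  have := onseg t t01; rewrite -eX -eY => XY.
  have side (a b : R * R) : open_segment a b (X, Y) -> meet u v a b by move=> ab; exists (X, Y).
  have ends (z : R) : 0 <= z <= 1 -> [\/ z = 0, z = 1 | 0 < z < 1].
    case/andP; rewrite !le_eqVlt => /orP[/eqP<-|z0]; first by constructor 1.
    by case/orP=> [/eqP->|z1]; [constructor 2|constructor 3; rewrite z0].
  case/orP: bd => /andP[/orP[] /eqP e0 /ends[] e1]; rewrite {}e0 ?e1 in XY side *;
    try first [by apply: (corner 0 0)|by apply: (corner 0 1)|by apply: (corner 1 0)|by apply: (corner 1 1)].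
  - by apply: s2; apply: side; exists Y => //; congr (_, _); rewrite /=; ring.
  - by apply: s3; apply: side; exists Y => //; congr (_, _); rewrite /=; ring.
  - by apply: s1; apply: side; exists X => //; congr (_, _); rewrite /=; ring.
  - by apply: s4; apply: side; exists X => //; congr (_, _); rewrite /=; ring.
case: ux => s s01 ex.
have /andP[hu1 hu2] : (0 <= u1 <= 1) && (0 <= u2 <= 1).
  apply: inside => t t01; exists ((1 - t) * s); first by apply/andP; split; nra.
  by rewrite ex /=; congr (_, _); ring.
have /andP[hv1 hv2] : (0 <= v1 <= 1) && (0 <= v2 <= 1).
  apply: inside => t t01; exists ((1 - t) * s + t); first by apply/andP; split; nra.
  by rewrite ex /=; congr (_, _); ring.
move: x1 x2; rewrite ex /=.
have int01 (w : int) : 0 <= w <= 1 -> w = 0 \/ w = 1 by lia.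
have [->|->] := int01 _ hu1; have [->|->] := int01 _ hu2;
have [->|->] := int01 _ hv1; have [->|->] := int01 _ hv2 => h1 h2; split => //; exfalso; lra.
Qed.

(** The line has slope [- (U2 - V2) / (V1 - U1)]; it crosses the vertical axis
    below height 1 and the horizontal axis beyond abscissa 1. *)
Lemma slope_lt1 (U1 U2 V1 V2 s : R) :
    0 < s < 1 -> U1 < V1 -> V2 < U2 -> V2 < 0 -> (1 - s) * U1 + s * V1 = 0 ->
    0 < (1 - s) * U2 + s * V2 < 1 ->
    (forall r : R, 0 < r < 1 -> (1 - r) * U2 + r * V2 = 0 ->
       ~ (0 < (1 - r) * U1 + r * V1 <= 1)) ->
  U2 - V2 < V1 - U1.
Proof.
move=> s01 p0 q0 V20 e1 t01 none.
have q0' : 0 < U2 - V2 by rewrite subr_gt0.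
have [r rE] : exists r, r * (U2 - V2) = U2 by exists (U2 / (U2 - V2)); rewrite divfK // gt_eqF.
have e2 : (1 - r) * U2 + r * V2 = 0.
  by have -> : (1 - r) * U2 + r * V2 = U2 - r * (U2 - V2) by [ring]; rewrite rE subrr.
have rs : 0 < (r - s) * (U2 - V2).
  have -> : (r - s) * (U2 - V2) = (1 - s) * U2 + s * V2 by rewrite mulrBl rE; ring.
  by case/andP: t01.
rewrite pmulr_lgt0 // in rs.
have r1 : r < 1 by rewrite -(ltr_pM2r q0') rE mul1r; move: V20; clear; lra.
have r0 : 0 < r by move: rs s01; clear; lra.
have := none r; rewrite r0 r1 => /(_ isT e2)/negP.
have -> : (1 - r) * U1 + r * V1 = (r - s) * (V1 - U1).
  by move: e1; clear; lra.
rewrite mulr_gt0 ?rs ?subr_gt0 //= -ltNge => big.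
rewrite -(ltr_pM2l (x := r - s)) ?rs //; apply: lt_trans big.
have -> : (r - s) * (U2 - V2) = (1 - s) * U2 + s * V2 by rewrite mulrBl rE; ring.
by case/andP: t01.
Qed.

Lemma between_open (a b z : R) : (a < z < b) || (b < z < a) ->
  exists2 r : R, 0 < r < 1 & z = (1 - r) * a + r * b.
Proof.
have main (a' b' : R) : a' < z < b' -> exists2 r : R, 0 < r < 1 & z = (1 - r) * a' + r * b'.
  case/andP=> az zb; have ab : 0 < b' - a' by rewrite subr_gt0 (lt_trans az).
  exists ((z - a') / (b' - a')).
    by rewrite ltr_pdivrMr // mul1r ltrD2r zb andbT divr_gt0 // subr_gt0.
  by field; rewrite gt_eqF.
case/orP => /main [r r01 ->]; first by exists r.
by exists (1 - r); [move: r01; clear; lra|ring].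
Qed.

(** The direction [(p', q')] of a lattice segment that crosses the side from
    [(0, 0)] to [(0, 1)] of the standard triangle, but not the base from [(0, 0)]
    to [(1, 0)].  Going right it passes at least two columns; if it descends, it
    must clear the base, so that its slope is above -1. *)
Lemma long_edge_crossing (u1 u2 v1 v2 : int) :
    let u := ipt u1 u2 in let v := ipt v1 v2 in
    let p := v1 - u1 in let q := v2 - u2 in
    meet u v (ipt 0 0) (ipt 0 1) -> ~ meet u v (ipt 0 0) (ipt 1 0) ->
    (forall i j : int, (i, j) \in [:: (0, 0); (1, 0); (0, 1)] -> ~ open_segment u v (ipt i j)) ->
    ~ (u1 = 0 /\ v1 = 0 /\ u2 + v2 = 1 /\ 0 <= u2 <= 1) ->
  exists p' q' : int, ((p = p' /\ q = q') \/ (p = - p' /\ q = - q')) /\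
     (2 <= p' /\ 0 <= q' \/ - p' < q' < 0).
Proof.
wlog uv : u1 u2 v1 v2 / u1 <= v1.
  move=> IH u v p q; have [|/ltW] := leP u1 v1; first exact: IH.
  move=> vu uva uvb nv nab.
  have [||||p' [q' [pq h]]] := IH v1 v2 u1 u2 vu.
  - by apply/meet_swapl.
  - by move/meet_swapl.
  - by move=> i j ij; rewrite open_segmentC; apply: nv.
  - lia.
  exists p', q'; split => //; move: pq; rewrite /p /q; lia.
move=> u v p q [x [[s s01 exs] [t t01 ext]]] nab nv ne.
move: exs; rewrite ext /= => -[]; rewrite !mulr0 addr0 !add0r mulr1 => e1 e2.
have lt0 (w : int) : (w%:~R < (0 : R)) = (w < 0) by rewrite (ltr_int R _ 0).
have gt0 (w : int) : ((0 : R) < w%:~R) = (0 < w) by rewrite (ltr_int R 0).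
have lt1 (w : int) : (w%:~R < (1 : R)) = (w < 1) by rewrite (ltr_int R _ 1).
have gt1 (w : int) : ((1 : R) < w%:~R) = (1 < w) by rewrite (ltr_int R 1).
have noz i j : (i, j) \in [:: (0, 0); (1, 0); (0, 1)] -> forall r : R, 0 < r < 1 ->
    i%:~R = (1 - r) * u1%:~R + r * v1%:~R -> j%:~R = (1 - r) * u2%:~R + r * v2%:~R -> False.
  move=> ij r r01 ei ej; apply: (nv i j ij); exists r => //.
  by rewrite /ipt ei ej.
have [euv|uv'] := eqVneq u1 v1.
  exfalso.
  have u0 : u1 = 0 by apply/eqP; rewrite -(intr_eq0 R); apply/eqP; move: e1; rewrite -euv; clear; lra.
  subst v1; rewrite {}u0 in ne e1 noz *.
  have hit (j : int) : (u2 < j < v2) || (v2 < j < u2) -> j = 0 \/ j = 1 -> False.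
    rewrite -!(ltr_int R) => /between_open[r r01 ej] j01.
    apply: (noz 0 j _ r) => //; last by rewrite mulr0z !mulr0 addr0.
    by case: j01 => ->.
  have [y1 y2] : ((0 : int)%:~R < v2%:~R :> R \/ (0 : int)%:~R < u2%:~R :> R) /\
                 (u2%:~R < (1 : int)%:~R :> R \/ v2%:~R < (1 : int)%:~R :> R).
    move: e2 t01 s01; rewrite mulr0z; clear => e2 t01 s01; split; apply/orP.
      by rewrite -[_ || _]negbK negb_or -!leNgt; apply/negP => /andP[]; nra.
    by rewrite -[_ || _]negbK negb_or -!leNgt; apply/negP => /andP[]; nra.
  move: y1 y2; rewrite !ltr_int => y1 y2.
  have h0 := hit 0; have h1 := hit 1; move: ne h0 h1 y1 y2; clear.
  move=> ne h0 h1 y1 y2.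
  have {}h0 : ~ ((u2 < 0 < v2) || (v2 < 0 < u2)) by move=> h; apply: h0; [|left].
  have {}h1 : ~ ((u2 < 1 < v2) || (v2 < 1 < u2)) by move=> h; apply: h1; [|right].
  apply: ne; split=> //; split=> //; lia.
have {uv uv'} uv : u1 < v1 by rewrite lt_neqAle uv' uv.
have uvR : (u1%:~R < v1%:~R :> R) by rewrite ltr_int.
have u1neg : u1 < 0 by rewrite -lt0; move: e1 uvR s01; clear; nra.
have v1pos : 0 < v1 by rewrite -gt0; move: e1 uvR s01; clear; nra.
exists p, q; split; first by left.
have [q0|q0] := leP 0 q; first by left; split=> //; move: u1neg v1pos; rewrite /p; clear; lia.
right; rewrite andbT /p /q.
rewrite -(ltr_int R) rmorphN !rmorphB /= ltrNl opprB.
have q0R : v2%:~R < u2%:~R :> R by rewrite ltr_int -subr_lt0.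
have [v2neg|v2pos] := ltP v2 0.
  apply: (slope_lt1 s01 uvR q0R _ (esym e1)); rewrite ?lt0 // -?e2 //.
  move=> r r01 er /andP[x0]; rewrite le_eqVlt => /orP[/eqP x1|x1].
    by apply: (noz 1 0 _ r) => //; rewrite ?er ?x1.
  apply: nab; exists ((1 - r) * u1%:~R + r * v1%:~R, 0); split.
    by exists r => //=; rewrite er.
  by exists ((1 - r) * u1%:~R + r * v1%:~R); [rewrite x0 x1|congr (_, _); rewrite /= ?mulr0z; ring].
have v20 : v2 = 0.
  apply/eqP; rewrite eq_le v2pos andbT -ltzD1 add0r -lt1.
  by move: e2 q0R t01 s01; clear; nra.
have V1 : (1 : R) <= v1%:~R by rewrite (ler_int R 1).
have s1 : 0 < 1 - s by move: s01; clear; lra.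
rewrite -(ltr_pM2l s1); move: e1 e2 V1 t01; rewrite v20 mulr0z; clear; lra.
Qed.
End LatticeGeometry.

(** * Edges between points of the grid *)

Section LatticePoints.
Variables (R : realType) (n : nat).
Local Notation T := ('I_n * 'I_n)%type.
Local Notation pos := (@lattice_pos R n).
Implicit Types (a b c d u v r : T).

Lemma edge_interior_set2 a b : edge_interior pos [set a; b] = open_segment (pos a) (pos b).
Proof.
apply/predeqP => x; split=> [[p [q [epq pq]]]|abx]; last by exists a, b.
have : (p \in [set a; b]) && (q \in [set a; b]) by rewrite epq !inE !eqxx orbT.
have : (a \in [set p; q]) && (b \in [set p; q]) by rewrite -epq !inE !eqxx orbT.
rewrite !inE => /andP[ha hb] /andP[/orP[]/eqP ep /orP[]/eqP eq]; subst p q => //.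
- by move: hb; rewrite orbb => /eqP ->.
- by rewrite open_segmentC.
- by move: ha; rewrite orbb => /eqP ->.
Qed.

Lemma straight_edgeP e : straight_edge pos e <->
  exists a b, [/\ e = [set a; b], a != b & forall r, ~ open_segment (pos a) (pos b) (pos r)].
Proof.
split=> [/andP[/cards2P[a [b [ab ->]]] /asboolP st]|[a [b [-> ab st]]]].
  by exists a, b; split => // r; rewrite -edge_interior_set2; apply: st.
rewrite /straight_edge cards2 ab /=; apply/asboolP => r.
by rewrite edge_interior_set2; apply: st.
Qed.

Lemma crossing_set2 a b c d : crossing pos [set a; b] [set c; d] <->
  [set a; b] != [set c; d] /\ meet (pos a) (pos b) (pos c) (pos d).
Proof.
rewrite /crossing !edge_interior_set2; split=> [/andP[-> /asboolP //]|[-> ?]] /=.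
exact/asboolP.
Qed.

Definition vec a b : int * int := ((b.1 : nat)%:Z - (a.1 : nat)%:Z, (b.2 : nat)%:Z - (a.2 : nat)%:Z).
Definition idet (e w : int * int) : int := e.1 * w.2 - e.2 * w.1.
Definition idot (e w : int * int) : int := e.1 * w.1 + e.2 * w.2.
Definition rvec (e : int * int) : R * R := ipt R e.1 e.2.

Lemma vec_inj a u v : vec a u = vec a v -> u = v.
Proof.
move: u v => [u1 u2] [v1 v2] [] /= /addIr [] /val_inj -> /addIr [] /val_inj -> //.
Qed.

Lemma pos_frame a u : pos u = frame (pos a) (1, 0) (0, 1) (rvec (vec a u)).
Proof.
by rewrite /frame /rvec /ipt /= !rmorphB /= -!pmulrn /lattice_pos -![in RHS]natr1 -![in LHS]natr1;
  congr (_, _); ring.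
Qed.

(** Cramer's rule, with a determinant that is its own inverse. *)
Lemma unimodular_coordinates a b c u : idet (vec a b) (vec a c) ^+ 2 = 1 ->
  exists i j : int, pos u = frame (pos a) (rvec (vec a b)) (rvec (vec a c)) (ipt R i j) /\
    vec a u = (i * (vec a b).1 + j * (vec a c).1, i * (vec a b).2 + j * (vec a c).2).
Proof.
set D := idet _ _ => D1.
exists (D * idet (vec a u) (vec a c)), (D * idet (vec a b) (vec a u)).
set i := D * _; set j := D * _.
have e : vec a u = (i * (vec a b).1 + j * (vec a c).1, i * (vec a b).2 + j * (vec a c).2).
  rewrite [LHS]surjective_pairing; congr (_, _).
    by rewrite -[LHS]mul1r -D1 /i /j /D /idet; ring.
  by rewrite -[LHS]mul1r -D1 /i /j /D /idet; ring.
split=> //; rewrite (pos_frame a) e /frame /rvec /ipt /=.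
by rewrite !rmorphD !rmorphM /=; congr (_, _); ring.
Qed.

Lemma det_rvec (e w : int * int) : det (rvec e) (rvec w) = (idet e w)%:~R.
Proof. by rewrite /det /rvec /ipt /idet /= rmorphB !rmorphM. Qed.

(** With [q >= 0] all terms of the quadratic form are nonnegative; with [q < 0]
    rewrite the vector as [(p + q) e + (- q) (e - w)], whose two summands also
    make an acute angle. *)
Lemma long_vector (e w : int * int) (p q : int) :
    0 < idot e w < idot e e -> (2 <= p /\ 0 <= q) \/ (- p < q < 0) ->
  idot e e < idot (p * e.1 + q * w.1, p * e.2 + q * w.2) (p * e.1 + q * w.1, p * e.2 + q * w.2).
Proof.
have -> : idot (p * e.1 + q * w.1, p * e.2 + q * w.2) (p * e.1 + q * w.1, p * e.2 + q * w.2)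
   = p ^+ 2 * idot e e + 2 * p * q * idot e w + q ^+ 2 * idot w w.
  by rewrite /idot /=; ring.
have W0 : 0 <= idot w w by rewrite /idot -!expr2 addr_ge0 ?sqr_ge0.
have W1 : 0 <= idot e e - 2 * idot e w + idot w w.
  have -> : idot e e - 2 * idot e w + idot w w = (e.1 - w.1) ^+ 2 + (e.2 - w.2) ^+ 2.
    by rewrite /idot; ring.
  by rewrite addr_ge0 ?sqr_ge0.
move: (idot e e) (idot e w) (idot w w) W0 W1 => E G W W0 W1 /andP[G0 GE] [[p2 q0]|/andP[pq q0]].
  have : 0 <= 2 * p * q * G by rewrite !mulr_ge0 //; lia.
  have : 0 <= q ^+ 2 * W by rewrite mulr_ge0 ?sqr_ge0.
  have : 4 * E <= p ^+ 2 * E by rewrite ler_pM2r; nia.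
  lia.
have -> : p ^+ 2 * E + 2 * p * q * G + q ^+ 2 * W =
   (p + q) ^+ 2 * E + 2 * (p + q) * (- q) * (E - G) + q ^+ 2 * (E - 2 * G + W) by ring.
have : 0 <= q ^+ 2 * (E - 2 * G + W) by rewrite mulr_ge0 ?sqr_ge0.
have : 0 < 2 * (p + q) * (- q) * (E - G) by rewrite !mulr_gt0 //; lia.
have : E <= (p + q) ^+ 2 * E by rewrite ler_peMl //; nia.
lia.
Qed.

(** In the frame of the triangle, an edge crossing the side [a c] but not the base
    [a b] has a direction to which [long_vector] applies, so it is longer than
    the base. *)
Lemma side_free a b c u v :
    idet (vec a b) (vec a c) ^+ 2 = 1 ->
    0 < idot (vec a b) (vec a c) < idot (vec a b) (vec a b) ->
    idot (vec u v) (vec u v) <= idot (vec a b) (vec a b) ->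
    (forall r, ~ open_segment (pos u) (pos v) (pos r)) ->
    (meet (pos u) (pos v) (pos a) (pos b) -> [set u; v] = [set a; b]) ->
  meet (pos u) (pos v) (pos a) (pos c) -> [set u; v] = [set a; c].
Proof.
move=> D1 dotP short st nab.
have det0 : det (rvec (vec a b)) (rvec (vec a c)) != 0.
  by rewrite det_rvec intr_eq0; apply: contra_eq_neq D1 => ->.
have [u1 [u2 [eu vu]]] := unimodular_coordinates u D1.
have [v1 [v2 [ev vv]]] := unimodular_coordinates v D1.
set F := frame (pos a) (rvec (vec a b)) (rvec (vec a c)) in eu ev.
have ea : pos a = F (ipt R 0 0) by rewrite [LHS]surjective_pairing /F /frame /= !mulr0z !mul0r !addr0.
have eb : pos b = F (ipt R 1 0).
  by rewrite /F (pos_frame a) /frame /=; congr (_, _); rewrite ?mulr0z; ring.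
have ec : pos c = F (ipt R 0 1).
  by rewrite /F (pos_frame a) /frame /=; congr (_, _); rewrite ?mulr0z; ring.
have coord (x y : T) (i j : int) :
   vec a x = (i * (vec a b).1 + j * (vec a c).1, i * (vec a b).2 + j * (vec a c).2) ->
   vec a y = (i * (vec a b).1 + j * (vec a c).1, i * (vec a b).2 + j * (vec a c).2) -> x = y.
  by move=> ex ey; apply: (@vec_inj a); rewrite ex ey.
have [mab|nmab] := pselect (meet (pos u) (pos v) (pos a) (pos b)).
  move=> [x [xu xc]]; exfalso; move: xu.
  rewrite -edge_interior_set2 (nab mab) edge_interior_set2 => xb.
  have : meet (pos a) (pos b) (pos a) (pos c) by exists x.
  rewrite ea eb ec meet_frame // => -[y [[s s01 ->]]] [t _ []] /=.
  by rewrite !mulr0z !mulr0 !add0r mulr1 => s0; move: s01; rewrite s0 ltxx.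
rewrite {1}eu {1}ev {1}ea {1}ec meet_frame // => muv.
have [ends|nends] := pselect (u1 = 0 /\ v1 = 0 /\ u2 + v2 = 1 /\ 0 <= u2 <= 1).
  case: ends => u10 [v10 [uv2 u201]].
  have va : vec a a = (0 * (vec a b).1 + 0 * (vec a c).1, 0 * (vec a b).2 + 0 * (vec a c).2).
    by rewrite !mul0r /vec !subrr.
  have vc : vec a c = (0 * (vec a b).1 + 1 * (vec a c).1, 0 * (vec a b).2 + 1 * (vec a c).2).
    by rewrite !mul0r !add0r !mul1r -surjective_pairing.
  have [u20|u21] : u2 = 0 \/ u2 = 1 by lia.
    have v21 : v2 = 1 by lia.
    by subst; congr [set _; _]; [apply: coord vu va|apply: coord vv vc].
  have v20 : v2 = 0 by lia.
  by subst; rewrite setUC; congr [set _; _]; [apply: coord vv va|apply: coord vu vc].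
have nmab' : ~ meet (ipt R u1 u2) (ipt R v1 v2) (ipt R 0 0) (ipt R 1 0).
  by move: nmab; rewrite eu ev ea eb meet_frame.
have noz i j : (i, j) \in [:: (0, 0); (1, 0); (0, 1)] ->
    ~ open_segment (ipt R u1 u2) (ipt R v1 v2) (ipt R i j).
  rewrite !inE => /or3P[] /eqP[-> ->].
  - by have := st a; rewrite eu ev ea open_segment_frame.
  - by have := st b; rewrite eu ev eb open_segment_frame.
  - by have := st c; rewrite eu ev ec open_segment_frame.
have [p [q [pq big]]] := long_edge_crossing muv nmab' noz nends.
have := long_vector dotP big; rewrite ltNge => /negP[].
suff -> : idot (p * (vec a b).1 + q * (vec a c).1, p * (vec a b).2 + q * (vec a c).2)
  (p * (vec a b).1 + q * (vec a c).1, p * (vec a b).2 + q * (vec a c).2) = idot (vec u v) (vec u v) by [].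
have -> : vec u v = ((vec a v).1 - (vec a u).1, (vec a v).2 - (vec a u).2).
  by rewrite /vec /=; congr (_, _); ring.
rewrite vu vv /idot /=.
by case: pq => -[ep eq]; [rewrite -ep -eq|rewrite -[p]opprK -[q]opprK -ep -eq]; ring.
Qed.

(** A unimodular parallelogram contains no lattice points besides its corners, so
    an edge that meets a diagonal and no side is itself a diagonal. *)
Lemma parallelogram_diagonal a b c d u v :
    vec a b = ((vec a c).1 + (vec a d).1, (vec a c).2 + (vec a d).2) ->
    idet (vec a c) (vec a d) ^+ 2 = 1 ->
    (forall r, ~ open_segment (pos u) (pos v) (pos r)) ->
    (forall x y, (x, y) \in [:: (a, c); (a, d); (c, b); (d, b)] ->
       meet (pos u) (pos v) (pos x) (pos y) -> [set u; v] = [set x; y]) ->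
    meet (pos u) (pos v) (pos a) (pos b) \/ meet (pos u) (pos v) (pos c) (pos d) ->
  [set u; v] = [set a; b] \/ [set u; v] = [set c; d].
Proof.
move=> vab D1 st sides cross.
have det0 : det (rvec (vec a c)) (rvec (vec a d)) != 0.
  by rewrite det_rvec intr_eq0; apply: contra_eq_neq D1 => ->.
have [u1 [u2 [eu vu]]] := unimodular_coordinates u D1.
have [v1 [v2 [ev vv]]] := unimodular_coordinates v D1.
set F := frame (pos a) (rvec (vec a c)) (rvec (vec a d)) in eu ev.
have coord (x y : T) (i j : int) :
   vec a x = (i * (vec a c).1 + j * (vec a d).1, i * (vec a c).2 + j * (vec a d).2) ->
   vec a y = (i * (vec a c).1 + j * (vec a d).1, i * (vec a c).2 + j * (vec a d).2) -> x = y.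
  by move=> ex ey; apply: (@vec_inj a); rewrite ex ey.
have posF x (i j : int) :
   vec a x = (i * (vec a c).1 + j * (vec a d).1, i * (vec a c).2 + j * (vec a d).2) ->
   pos x = F (ipt R i j).
  move=> ex; rewrite (pos_frame a) ex /F /frame /rvec /ipt /=.
  by rewrite !rmorphD !rmorphM /=; congr (_, _); ring.
have va : vec a a = (0 * (vec a c).1 + 0 * (vec a d).1, 0 * (vec a c).2 + 0 * (vec a d).2).
  by rewrite !mul0r /vec !subrr.
have vc : vec a c = (1 * (vec a c).1 + 0 * (vec a d).1, 1 * (vec a c).2 + 0 * (vec a d).2).
  by rewrite !mul0r !addr0 !mul1r -surjective_pairing.
have vd : vec a d = (0 * (vec a c).1 + 1 * (vec a d).1, 0 * (vec a c).2 + 1 * (vec a d).2).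
  by rewrite !mul0r !add0r !mul1r -surjective_pairing.
have vb : vec a b = (1 * (vec a c).1 + 1 * (vec a d).1, 1 * (vec a c).2 + 1 * (vec a d).2).
  by rewrite !mul1r.
have [ea eb ec ed] := And4 (posF _ _ _ va) (posF _ _ _ vb) (posF _ _ _ vc) (posF _ _ _ vd).
have [x [xu x1 x2]] : exists x, [/\ open_segment (ipt R u1 u2) (ipt R v1 v2) x, 0 < x.1 < 1 & 0 < x.2 < 1].
  move: cross; rewrite eu ev ea eb ec ed !meet_frame //.
  case=> -[x [xu [t t01 ex]]]; exists x; split=> //;
    rewrite ex /= ?mulr0z; move: t01; clear; lra.
have noside p q (i j k l : int) :
    pos p = F (ipt R i j) -> pos q = F (ipt R k l) ->
    (p, q) \in [:: (a, c); (a, d); (c, b); (d, b)] ->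
    (forall s : R, 0 < s < 1 -> (1 - s) * i%:~R + s * k%:~R = x.1 ->
       (1 - s) * j%:~R + s * l%:~R = x.2 -> False) ->
    ~ meet (ipt R u1 u2) (ipt R v1 v2) (ipt R i j) (ipt R k l).
  move=> ep eq pq no; rewrite -(meet_frame (pos a) _ _ _ _ det0) -/F -eu -ev -ep -eq => m.
  have e := sides _ _ pq m.
  move: xu; rewrite -(open_segment_frame (pos a) _ _ _ det0) -/F -eu -ev.
  rewrite -edge_interior_set2 e edge_interior_set2 ep eq open_segment_frame //.
  by case=> s s01 ex; apply: (no s s01); rewrite ex.
have noz (i j : int) : 0 <= i <= 1 -> 0 <= j <= 1 ->
    ~ open_segment (ipt R u1 u2) (ipt R v1 v2) (ipt R i j).
  move=> i01 j01; rewrite -(open_segment_frame (pos a) _ _ _ det0) -/F -eu -ev.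
  have [->|->] : i = 0 \/ i = 1 by move: i01; clear; lia.
    by have [->|->] : j = 0 \/ j = 1 by [move: j01; clear; lia]; rewrite -?ea -?ed; apply: st.
  by have [->|->] : j = 0 \/ j = 1 by [move: j01; clear; lia]; rewrite -?ec -?eb; apply: st.
have [||||h1 h2 h3 h4] := unit_square_diagonal x1 x2 xu _ _ _ _ noz.
- by apply: noside ea ec _ _ => //; rewrite ?inE ?eqxx // => s s01; rewrite mulr0z; move: x2; clear; lra.
- by apply: noside ea ed _ _ => //; rewrite ?inE ?eqxx ?orbT // => s s01; rewrite mulr0z; move: x1; clear; lra.
- by apply: noside ec eb _ _ => //; rewrite ?inE ?eqxx ?orbT // => s s01; rewrite ?mulr0z; move: x1; clear; lra.
- by apply: noside ed eb _ _ => //; rewrite ?inE ?eqxx ?orbT // => s s01; rewrite ?mulr0z; move: x2; clear; lra.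
have [u10|u11] : u1 = 0 \/ u1 = 1 by move: h3; clear; lia.
  have v11 : v1 = 1 by move: h1 u10; clear; lia.
  have [u20|u21] : u2 = 0 \/ u2 = 1 by move: h4; clear; lia.
    have v21 : v2 = 1 by move: h2 u20; clear; lia.
    by left; subst; congr [set _; _]; [apply: coord vu va|apply: coord vv vb].
  have v20 : v2 = 0 by move: h2 u21; clear; lia.
  by right; rewrite setUC; subst; congr [set _; _]; [apply: coord vv vc|apply: coord vu vd].
have v10 : v1 = 0 by move: h1 u11; clear; lia.
have [u20|u21] : u2 = 0 \/ u2 = 1 by move: h4; clear; lia.
  have v21 : v2 = 1 by move: h2 u20; clear; lia.
  by right; subst; congr [set _; _]; [apply: coord vu vc|apply: coord vv vd].
have v20 : v2 = 0 by move: h2 u21; clear; lia.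
by left; rewrite setUC; subst; congr [set _; _]; [apply: coord vv va|apply: coord vu vb].
Qed.

End LatticePoints.

(** * Flips that shorten the longest edge *)

Section Flips.
Variables (R : realType) (n : nat).
Local Notation T := ('I_n * 'I_n)%type.
Local Notation pos := (@lattice_pos R n).
Implicit Types (a b c d u v r : T).

Definition standard_edges : {set {set T}} :=
  [set e | [exists a : T, exists b : T,
     (vec a b \in [:: (1, 0); (0, 1); (1, 1)]) && (e == [set a; b])]].

(** Four times the squared length, plus 1 for the direction [(1, -1)]: each flip
    below decreases this weight, including the one that replaces the antidiagonal
    of a unit square by its diagonal, of equal length. *)
Definition pair_weight a b : nat :=
  (2 * `|idot (vec a b) (vec a b)| + (vec a b == (1, -1)%R))%N.

Definition weight (e : {set T}) : nat :=
  (\sum_(a in e) \sum_(b in e) pair_weight a b)%N.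

Lemma weight_set2 a b : a != b -> weight [set a; b] = (pair_weight a b + pair_weight b a)%N.
Proof.
move=> ab.
have w0 c : pair_weight c c = 0%N by rewrite /pair_weight /vec !subrr.
by rewrite /weight !big_setU1 ?inE //= !big_set1 !big_setU1 ?inE //= !big_set1 !w0 add0n addn0.
Qed.

Lemma vecN a b : vec b a = (- (vec a b).1, - (vec a b).2).
Proof. by rewrite /vec /= !opprB. Qed.

Lemma weightE a b : a != b -> weight [set a; b] =
  (4 * `|idot (vec a b) (vec a b)| + ((vec a b == (1, -1)%R) + (vec a b == (-1, 1)%R)))%N.
Proof.
move=> ab; rewrite weight_set2 // /pair_weight vecN.
case: (vec a b) => x y; rewrite /idot /= !mulrNN !xpair_eqE !eqr_oppLR opprK.
by move: `|_|%N (_ && _) (_ && _) => E s t; lia.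
Qed.

Lemma box_coordinate (i j : 'I_n) (k : int) :
  (0 <= k <= j%:Z - i%:Z) || (j%:Z - i%:Z <= k <= 0) -> exists l : 'I_n, l%:Z - i%:Z = k.
Proof.
move=> kij; have ln : (`|(i%:Z + k)%R| < n)%N by have := ltn_ord i; have := ltn_ord j; lia.
by exists (Ordinal ln) => /=; have := ltn_ord i; have := ltn_ord j; lia.
Qed.

Lemma box_point a b (e : int * int) :
    (0 <= e.1 <= (vec a b).1) || ((vec a b).1 <= e.1 <= 0) ->
    (0 <= e.2 <= (vec a b).2) || ((vec a b).2 <= e.2 <= 0) ->
  exists c, vec a c = e.
Proof.
move=> /box_coordinate[l1 e1] /box_coordinate[l2 e2].
by exists (l1, l2); rewrite /vec /= e1 e2 -surjective_pairing.
Qed.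

(** Dividing the vector of the edge by a common divisor of its coordinates would
    give a grid point in its interior. *)
Lemma straight_coprime a b : a != b ->
    (forall r, ~ open_segment (pos a) (pos b) (pos r)) ->
  coprime `|(vec a b).1| `|(vec a b).2|.
Proof.
move=> ab st; set g := gcdn `|(vec a b).1| `|(vec a b).2|.
have [/dvdnP[k1 e1] /dvdnP[k2 e2]] := (dvdn_gcdl `|(vec a b).1| `|(vec a b).2|, dvdn_gcdr `|(vec a b).1| `|(vec a b).2|).
rewrite -/g in e1 e2.
have g0 : (0 < g)%N.
  rewrite lt0n; apply: contra_neqN ab => /eqP g0; apply: (@vec_inj _ a).
  rewrite {1}/vec !subrr [RHS]surjective_pairing; congr (_, _); apply/eqP;
    by rewrite eq_sym -absz_eq0 ?e1 ?e2 g0 muln0.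
rewrite /coprime -/g eqn_leq g0 andbT leqNgt; apply/negP => g1.
have sgnE (z : int) k : `|z|%N = (k * g)%N -> exists m : int,
    z = g%:Z * m /\ ((0 <= m <= z) || (z <= m <= 0)).
  move=> ez; exists (sgz z * k%:Z).
  have kz : (k <= `|z|)%N by rewrite ez leq_pmulr.
  split; first by rewrite {1}[z]intEsg ez PoszM; ring.
  by case: (sgzP z) => z0; rewrite ?mul0r ?mul1r ?mulN1r; lia.
have [m1 [v1 b1]] := sgnE _ _ e1.
have [m2 [v2 b2]] := sgnE _ _ e2.
have [r er] := box_point (e := (m1, m2)) b1 b2.
have gR : (g%:R : R) != 0 by rewrite pnatr_eq0 -lt0n.
apply: (st r); exists (g%:R^-1).
  by rewrite invr_gt0 ltr0n g0 invf_lt1 ?ltr0n // ltr1n.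
have vab : vec a b = (g%:Z * m1, g%:Z * m2) by rewrite [LHS]surjective_pairing v1 v2.
rewrite (pos_frame R a r) (pos_frame R a b) er vab /frame /rvec /ipt /= !rmorphM /= -!pmulrn.
by congr (_, _); field.
Qed.

(** Bezout coefficients of the coprime coordinates of the edge give an apex [c]
    of a unimodular triangle over it, chosen inside the bounding box of the edge,
    so that [c] and its reflection [d] are points of the grid.  As [c - a] and
    [d - a] lie in one quadrant, the other diagonal is shorter, unless the box is
    a unit square. *)
Lemma exists_flip a b : a != b ->
    (forall r, ~ open_segment (pos a) (pos b) (pos r)) -> [set a; b] \notin standard_edges ->
  exists c d, [/\ vec a b = ((vec a c).1 + (vec a d).1, (vec a c).2 + (vec a d).2),
    idet (vec a c) (vec a d) ^+ 2 = 1,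
    0 < idot (vec a b) (vec a c) < idot (vec a b) (vec a b),
    c != d & (weight [set c; d] < weight [set a; b])%N].
Proof.
wlog ab1 : a b / 0 <= (vec a b).1.
  move=> IH ab st nstd; have [|/ltW ba1] := leP 0 (vec a b).1; first by move=> h; apply: IH.
  have [||||c [d [par D1 dotP cd w]]] := IH b a.
  - by rewrite vecN oppr_ge0.
  - by rewrite eq_sym.
  - by move=> r; rewrite open_segmentC.
  - by rewrite setUC.
  have [eac ead] : vec a c = (- (vec b d).1, - (vec b d).2) /\ vec a d = (- (vec b c).1, - (vec b c).2).
    by case: par; rewrite /vec /= => h1 h2; split; congr (_, _); move: h1 h2; clear; lia.
  exists c, d; split=> //; last by rewrite [X in (_ < weight X)%N]setUC.
  - by rewrite vecN par eac ead /=; congr (_, _); ring.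
  - by rewrite -D1 eac ead /idet /=; ring.
  - rewrite vecN par eac; move: dotP; rewrite par /idot /=; clear; lia.
move=> ab st nstd; have cop := straight_coprime ab st.
have [V1 [V2 V2s]] : exists V1 V2, vec a b = (V1, V2) by exists (vec a b).1, (vec a b).2; rewrite -surjective_pairing.
rewrite V2s /= in ab1 cop.
have std (e : int * int) : e \in [:: (1, 0); (0, 1); (1, 1)] -> vec a b <> e /\ vec b a <> e.
  move=> es; split=> ee; move/negP: nstd; apply; rewrite inE.
    by apply/existsP; exists a; apply/existsP; exists b; rewrite ee es eqxx.
  by apply/existsP; exists b; apply/existsP; exists a; rewrite ee es setUC eqxx.
have p0 : 0 < V1.
  rewrite lt_neqAle ab1 andbT; apply/negP => /eqP V10.
  move: cop; rewrite -V10 absz0 /coprime gcd0n => /eqP V21.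
  have [/eqP|/eqP] : V2 = 1 \/ V2 = -1 by move: V21; clear; lia.
    by move/eqP=> e2; have [] := std (0, 1) isT; rewrite V2s -V10 e2.
  by move/eqP=> e2; have [_] := std (0, 1) isT; rewrite vecN V2s -V10 e2.
have q0 : V2 != 0.
  apply/eqP => V20; move: cop; rewrite V20 absz0 /coprime gcdn0 => /eqP V11.
  by apply: (proj1 (std (1, 0) isT)); rewrite V2s V20; congr (_, _); move: V11 p0; clear; lia.
have pN : (0 < `|V1|)%N by move: p0; clear; lia.
have [k [l [bez lp]]] : exists k l : nat, (k * `|V1| = l * `|V2| + 1)%N /\ (l < `|V1|)%N.
  by case: (egcdnP `|V2| pN) => k l; rewrite (eqP cop) muln1 => *; exists k, l.
have [p Vp] : exists p : nat, V1 = p%:Z by exists `|V1|%N; move: p0; clear; lia.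
have [q [sg [Vq sg1 qp]]] : exists (q : nat) (sg : int), [/\ V2 = sg * q%:Z, sg = 1 \/ sg = -1 & (0 < q)%N].
  exists `|V2|%N, (sgz V2); rewrite absz_gt0 q0 -intEsg; split=> //.
  by move: q0; case: (sgzP V2) => // _ _; [left|right].
have V2q : `|V2|%N = q by rewrite Vq; case: sg1 => ->; clear; lia.
move: bez lp; rewrite V2q Vp absz_nat => bez lp {pN}.
have kq : (k <= q)%N by move: bez lp qp; clear; nia.
have k0 : (0 < k)%N by move: bez; clear; nia.
have [c ec] : exists c, vec a c = (l%:Z, sg * k%:Z).
  apply: (box_point (b := b)); rewrite V2s /= ?Vp ?Vq; first by move: lp; clear; lia.
  by case: sg1 => ->; move: kq; clear; lia.
have [d ed] : exists d, vec a d = (p%:Z - l%:Z, sg * (q%:Z - k%:Z)).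
  apply: (box_point (b := b)); rewrite V2s /= ?Vp ?Vq; first by move: lp; clear; lia.
  by case: sg1 => ->; move: kq; clear; lia.
have sg2 : sg * sg = 1 by case: sg1 => ->.
have ecd : vec c d = (p%:Z - 2 * l%:Z, sg * (q%:Z - 2 * k%:Z)).
  move: ec ed; rewrite /vec => -[c1 c2] [d1 d2]; congr (_, _); first by move: c1 d1; clear; lia.
  have -> : d.2%:Z - c.2%:Z = (d.2%:Z - a.2%:Z) - (c.2%:Z - a.2%:Z) by ring.
  by rewrite c2 d2; ring.
have bezZ : k%:Z * p%:Z = l%:Z * q%:Z + 1 by move: bez; clear; lia.
have vab : vec a b = (p%:Z, sg * q%:Z) by rewrite V2s Vp Vq.
have nstd' : ~ (sg = 1 /\ (p = 1 /\ q = 1))%N.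
  by case=> sg11 [p1 q1]; apply: (proj1 (std (1, 1) isT)); rewrite vab p1 q1 sg11.
have cd : c != d.
  apply/eqP => ecd'; move: ecd; rewrite ecd' /vec !subrr => -[h1 h2].
  have h3 : q%:Z = 2 * k%:Z by case: sg1 h2 => ->; clear; lia.
  by move: bezZ; rewrite h3 (_ : p%:Z = 2 * l%:Z); move: h1; clear; lia.
exists c, d; rewrite vab ec ed; split=> //=.
- by congr (_, _); ring.
- rewrite /idet /=.
  have -> : l%:Z * (sg * (q%:Z - k%:Z)) - sg * k%:Z * (p%:Z - l%:Z) = sg * (l%:Z * q%:Z - k%:Z * p%:Z) by ring.
  by rewrite bezZ expr2; case: sg1 => ->; ring.
- rewrite /idot /=.
  have -> : sg * q%:Z * (sg * k%:Z) = q%:Z * k%:Z by rewrite mulrACA sg2 mul1r.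
  have -> : sg * q%:Z * (sg * q%:Z) = q%:Z * q%:Z by rewrite mulrACA sg2 mul1r.
  by move: kq k0 lp qp; clear; nia.
- rewrite !weightE // ecd vab.
  have -> : idot (p%:Z - 2 * l%:Z, sg * (q%:Z - 2 * k%:Z)) (p%:Z - 2 * l%:Z, sg * (q%:Z - 2 * k%:Z))
     = p%:Z ^+ 2 + q%:Z ^+ 2 - 4 * (l%:Z * (p%:Z - l%:Z) + k%:Z * (q%:Z - k%:Z)).
    rewrite /idot /= [X in _ + X](_ : _ = sg * sg * (q%:Z - 2 * k%:Z) ^+ 2); last by ring.
    by rewrite sg2; ring.
  have -> : idot (p%:Z, sg * q%:Z) (p%:Z, sg * q%:Z) = p%:Z ^+ 2 + q%:Z ^+ 2.
    by rewrite /idot /= [X in _ + X](_ : _ = sg * sg * q%:Z ^+ 2); [rewrite sg2; ring|ring].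
  have [X0|X0] := posnP (l * (p - l) + k * (q - k))%N.
    have l0 : l = 0%N.
      move: X0 => /eqP; rewrite addn_eq0 muln_eq0 => /andP[/orP[/eqP //|/eqP pl] _].
      by move: pl lp; clear; lia.
    have [k1 p1] : k = 1%N /\ p = 1%N.
      by move/eqP: bez; rewrite l0 mul0n add0n muln_eq1 => /andP[/eqP-> /eqP->].
    have q1 : q = 1%N by move: X0 kq; rewrite l0 k1; clear; lia.
    case: sg1 => sgE; first by case: nstd'.
    by rewrite l0 k1 p1 q1 sgE.
  have E0 : 0 <= p%:Z ^+ 2 + q%:Z ^+ 2 - 4 * (l%:Z * (p%:Z - l%:Z) + k%:Z * (q%:Z - k%:Z)).
    have -> : p%:Z ^+ 2 + q%:Z ^+ 2 - 4 * (l%:Z * (p%:Z - l%:Z) + k%:Z * (q%:Z - k%:Z))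
      = (p%:Z - 2 * l%:Z) ^+ 2 + (q%:Z - 2 * k%:Z) ^+ 2 by ring.
    by rewrite addr_ge0 ?sqr_ge0.
  have X1 : 0 < l%:Z * (p%:Z - l%:Z) + k%:Z * (q%:Z - k%:Z).
    by rewrite subzn ?(ltnW lp) // subzn // -!PoszM -PoszD ltz_nat.
  have le1 (x : int * int) : ((x == (1, -1)%R) + (x == (-1, 1)%R) <= 1)%N.
    by have [->|_] := eqVneq x (1, -1)%R; rewrite // add0n leq_b1.
  apply: leq_ltn_trans (leq_add (leqnn _) (le1 _)) _; apply: leq_trans (leq_addr _ _).
  move: (_ + _ ^+ 2) (l%:Z * _ + _) E0 X1 => E X; clear; lia.
Qed.
End Flips.

Section Connectivity.
Variables (R : realType) (n : nat).
Local Notation T := ('I_n * 'I_n)%type.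
Local Notation pos := (@lattice_pos R n).
Implicit Types (a b c d u v r : T) (e f g : {set T}) (A B : {set {set T}}).

Lemma vecaa a : vec a a = (0, 0).
Proof. by rewrite /vec !subrr. Qed.

Lemma noncrossingP A : noncrossing pos A <->
  (forall e, e \in A -> straight_edge pos e) /\
  (forall e f, e \in A -> f \in A -> ~ crossing pos e f).
Proof.
rewrite /noncrossing; split=> [/andP[/forall_inP h1 /forall_inP h2]|[h1 h2]].
  by split=> // e f eA fA; have /forall_inP/(_ f fA)/negP := h2 e eA.
apply/andP; split; first exact/forall_inP.
by apply/forall_inP => e eA; apply/forall_inP => f fA; apply/negP; apply: h2.
Qed.

Lemma crossingC e f : crossing pos e f <-> crossing pos f e.
Proof. by rewrite /crossing eq_sym classical_sets.setIC. Qed.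

Lemma maximal_add A e : maxset (noncrossing pos) A -> straight_edge pos e ->
  (forall f, f \in A -> ~ crossing pos e f) -> e \in A.
Proof.
case/maxsetP=> /noncrossingP[h1 h2] maxA ste nc.
have <- : e |: A = A; last by rewrite setU11.
apply: maxA; last exact: subsetUr.
apply/noncrossingP; split=> [f|f g]; first by case/setU1P=> [->|/h1].
case/setU1P=> [->|fA] /setU1P[->|gA] //.
- by rewrite /crossing eqxx.
- exact: nc.
- by rewrite crossingC; apply: nc.
- exact: h2.
Qed.

Lemma unimodular_neq a b c : idet (vec a b) (vec a c) ^+ 2 = 1 -> a != b.
Proof. by move=> D1; apply: contra_eq_neq D1 => ->; rewrite vecaa /idet !mul0r subrr. Qed.

Lemma unimodular_straight a b c : idet (vec a b) (vec a c) ^+ 2 = 1 ->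
  straight_edge pos [set a; b].
Proof.
move=> D1; apply/straight_edgeP; exists a, b; split=> // [|r]; first exact: unimodular_neq D1.
have det0 : det (rvec R (vec a b)) (rvec R (vec a c)) != 0.
  by rewrite det_rvec intr_eq0; apply: contra_eq_neq D1 => ->.
have [i [j [er _]]] := unimodular_coordinates R r D1.
have ea : pos a = frame (pos a) (rvec R (vec a b)) (rvec R (vec a c)) (ipt R 0 0).
  by rewrite [LHS]surjective_pairing /frame /= !mulr0z !mul0r !addr0.
have eb : pos b = frame (pos a) (rvec R (vec a b)) (rvec R (vec a c)) (ipt R 1 0).
  by rewrite (pos_frame R a b) /frame /=; congr (_, _); rewrite ?mulr0z; ring.
rewrite er {1}ea eb open_segment_frame // => -[s s01 []] /= ei _.
have : (0 : int)%:~R < (i%:~R : R) < (1 : int)%:~R.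
  by rewrite ei mulr0z mulr0 add0r mulr1.
by rewrite !ltr_int; lia.
Qed.

Lemma crossing_diagonals a b c d :
    vec a b = ((vec a c).1 + (vec a d).1, (vec a c).2 + (vec a d).2) ->
  meet (pos a) (pos b) (pos c) (pos d).
Proof.
move=> vab; exists (((pos a).1 + (pos b).1) / 2, ((pos a).2 + (pos b).2) / 2); split.
  by exists (1 / 2); [lra|congr (_, _); field].
exists (1 / 2); first lra.
rewrite (pos_frame R a b) (pos_frame R a c) (pos_frame R a d) vab /frame /rvec /ipt /=.
by rewrite !rmorphD /=; congr (_, _); field.
Qed.

Lemma idet_sqr_frames a b c d :
    vec a b = ((vec a c).1 + (vec a d).1, (vec a c).2 + (vec a d).2) ->
    idet (vec a c) (vec a d) ^+ 2 = 1 ->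
  [/\ idet (vec a b) (vec a c) ^+ 2 = 1, idet (vec a b) (vec a d) ^+ 2 = 1,
      idet (vec b a) (vec b c) ^+ 2 = 1, idet (vec b a) (vec b d) ^+ 2 = 1 &
      idet (vec c d) (vec c a) ^+ 2 = 1] /\
  idet (vec a d) (vec a c) ^+ 2 = 1 /\
  idet (vec c b) (vec c a) ^+ 2 = 1 /\ idet (vec d b) (vec d a) ^+ 2 = 1.
Proof.
move=> vab D1.
have sub x y : vec x y = ((vec a y).1 - (vec a x).1, (vec a y).2 - (vec a x).2).
  by rewrite /vec /=; congr (_, _); ring.
rewrite (sub b a) (sub b c) (sub b d) (sub c d) (sub c a) (sub c b) (sub d b) (sub d a) vab.
rewrite vecaa.
by move: D1; rewrite /idet /= => <-; split; [split; ring|split; [ring|split; ring]].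
Qed.

(** Among the nonstandard edges take one of largest weight; it is a longest edge.
    By [side_free] no edge crosses the sides of its unimodular parallelogram, so
    maximality puts these sides into [A], and by [parallelogram_diagonal] the
    other diagonal crosses nothing else.  The same two facts show that the
    exchange keeps the set maximal. *)
Lemma shortening_flip A : maxset (noncrossing pos) A -> A != standard_edges n ->
    noncrossing pos (standard_edges n) ->
  exists a b c d, let e := [set a; b] in let f := [set c; d] in
    [/\ vec a b = ((vec a c).1 + (vec a d).1, (vec a c).2 + (vec a d).2),
        e \in A, f \notin A, (weight f < weight e)%N
      & maxset (noncrossing pos) (f |: A :\ e)].
Proof.
move=> maxA nstd ncD; have [/noncrossingP[stA ncA] maxA'] := maxsetP maxA.
have [e0 e0A e0D] : exists2 e, e \in A & e \notin standard_edges n.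
  apply/subsetPn; apply: contra nstd => AD; apply/eqP/esym; exact: maxA'.
have e0AD : e0 \in A :\: standard_edges n by rewrite inE e0D.
case: (arg_maxnP (@weight n) e0AD) => e /setDP[eA eD] emax.
have /straight_edgeP[a [b [eE ab st]]] := stA e eA.
rewrite eE in eD eA emax; have [c [d [vab D1 dotP cd wlt]]] := exists_flip ab st eD.
have [[Dabc Dabd Dbac Dbad Dcd] [Dad [Dcb Ddb]]] := idet_sqr_frames vab D1.
have short u v : u != v -> [set u; v] \in A -> idot (vec u v) (vec u v) <= idot (vec a b) (vec a b).
  move=> uv uvA; have [|uvD] := boolP ([set u; v] \in standard_edges n).
    rewrite inE => /existsP[x /existsP[y /andP[xy /eqP eqxy]]].
    have E2 : 2 <= idot (vec a b) (vec a b) by move: dotP; clear; lia.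
    apply: le_trans E2.
    have xy' : x != y.
      by apply: contraTneq xy => ->; rewrite vecaa.
    have := weightE xy'; rewrite -eqxy weightE //.
    move: xy; rewrite !inE => /or3P[]/eqP ->; rewrite /idot /=; clear; lia.
  have uvAD : [set u; v] \in A :\: standard_edges n by rewrite inE uvD.
  have := emax _ uvAD.
  rewrite !weightE //.
  have le1 (x : int * int) : ((x == (1, -1)%R) + (x == (-1, 1)%R) <= 1)%N.
    by have [->|_] := eqVneq x (1, -1)%R; rewrite // add0n leq_b1.
  have := le1 (vec a b); have : 0 <= idot (vec u v) (vec u v) by rewrite /idot -!expr2 addr_ge0 ?sqr_ge0.
  have cancel (x y : int) (i j : nat) : (j <= 1)%N -> 0 <= x -> 0 < y ->
      (4 * `|x| + i <= 4 * `|y| + j)%N -> x <= y by clear; lia.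
  by move=> x0 j1; apply: cancel => //; case/andP: dotP; apply: lt_trans.
have meetA u v x y : [set u; v] \in A -> [set x; y] \in A ->
    meet (pos u) (pos v) (pos x) (pos y) -> [set u; v] = [set x; y].
  move=> uvA xyA m; apply/eqP/negPn/negP => ne.
  by apply: (ncA _ _ uvA xyA); apply/crossing_set2.
have abA := eA.
have dot' : [/\ 0 < idot (vec a b) (vec a d) < idot (vec a b) (vec a b),
    0 < idot (vec b a) (vec b c) < idot (vec b a) (vec b a),
    0 < idot (vec b a) (vec b d) < idot (vec b a) (vec b a) &
    idot (vec b a) (vec b a) = idot (vec a b) (vec a b)].
  have sub x y : vec x y = ((vec a y).1 - (vec a x).1, (vec a y).2 - (vec a x).2).
    by rewrite /vec /=; congr (_, _); ring.
  rewrite (sub b a) (sub b c) (sub b d) vecaa; move: dotP; rewrite vab /idot /=; clear.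
  by move=> h; split; nia.
have [dotad dotbc dotbd Eba] := dot'.
have sidesA x y : (x, y) \in [:: (a, c); (a, d); (c, b); (d, b)] -> [set x; y] \in A.
  move=> xyP; have stxy : straight_edge pos [set x; y].
    move: xyP; rewrite !inE => /or4P[]/eqP[-> ->].
    - exact: unimodular_straight D1.
    - exact: unimodular_straight Dad.
    - exact: unimodular_straight Dcb.
    - exact: unimodular_straight Ddb.
  apply: maximal_add maxA stxy _ => f fA.
  have /straight_edgeP[u [v [fE uv stf]]] := stA f fA; rewrite {}fE in fA *.
  rewrite crossingC => /crossing_set2[/eqP + m]; apply.
  have mab := meetA u v a b fA abA.
  have mba : meet (pos u) (pos v) (pos b) (pos a) -> [set u; v] = [set b; a].
    by rewrite meet_swapr [RHS]setUC.
  have sh := short u v uv fA.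
  move: xyP m; rewrite !inE => /or4P[]/eqP[-> ->].
  - exact: side_free Dabc dotP sh stf mab.
  - exact: side_free Dabd dotad sh stf mab.
  - by rewrite meet_swapr [X in _ = X]setUC; apply: side_free Dbac dotbc _ stf mba; rewrite Eba.
  - by rewrite meet_swapr [X in _ = X]setUC; apply: side_free Dbad dotbd _ stf mba; rewrite Eba.
have crossA : meet (pos a) (pos b) (pos c) (pos d) by exact: crossing_diagonals vab.
have neq : [set c; d] != [set a; b] by apply: contraTneq wlt => ->; rewrite ltnn.
have cdA : [set c; d] \notin A.
  by apply: contra neq => cdA; rewrite (meetA _ _ _ _ abA cdA crossA).
have diag (B : {set {set T}}) g : (forall x y, (x, y) \in [:: (a, c); (a, d); (c, b); (d, b)] -> [set x; y] \in B) ->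
    noncrossing pos B -> g \in B -> crossing pos g [set a; b] \/ crossing pos g [set c; d] ->
    g = [set a; b] \/ g = [set c; d].
  move=> sidesB /noncrossingP[stB ncB] gB.
  have /straight_edgeP[u [v [gE uv stg]]] := stB g gB; rewrite {}gE in gB *.
  move=> cr; apply: (parallelogram_diagonal vab D1 stg); last first.
    by case: cr => /crossing_set2[_]; [left|right].
  move=> x y /sidesB xyB m; apply/eqP/negPn/negP => ne.
  by apply: (ncB _ _ gB xyB); apply/crossing_set2.
have stcd : straight_edge pos [set c; d] by exact: unimodular_straight Dcd.
exists a, b, c, d; split=> //; apply/maxsetP; split.
  apply/noncrossingP; split=> [f|f g].
    by case/setU1P=> [-> //|/setD1P[_]]; apply: stA.
  have main g' : g' \in A :\ [set a; b] -> ~ crossing pos g' [set c; d].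
    case/setD1P=> gab gA cr.
    have [/eqP|gcd] := diag A g' sidesA (maxsetP maxA).1 gA (or_intror cr).
      by rewrite (negPf gab).
    by rewrite gcd (negPf cdA) in gA.
  case/setU1P=> [->|fA] /setU1P[->|gA].
  - by rewrite /crossing eqxx.
  - by rewrite crossingC; apply: main.
  - exact: main.
  - by apply: ncA; [case/setD1P: fA|case/setD1P: gA].
move=> B ncB AB; apply/eqP; rewrite eqEsubset AB andbT; apply/subsetP => g gB.
have cdB : [set c; d] \in B by apply: (subsetP AB); rewrite setU11.
have sidesB x y : (x, y) \in [:: (a, c); (a, d); (c, b); (d, b)] -> [set x; y] \in B.
  move=> xy; apply: (subsetP AB); rewrite inE orbC in_setD1 sidesA // andbT.
  apply/orP; left; move: xy.
  have [ca da] := (unimodular_neq D1, unimodular_neq Dad).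
  have [cb db] := (unimodular_neq Dcb, unimodular_neq Ddb).
  have cab : c \notin [set a; b] by rewrite !inE negb_or eq_sym ca cb.
  have dab : d \notin [set a; b] by rewrite !inE negb_or eq_sym da db.
  rewrite !inE => /or4P[]/eqP[-> ->].
  - by apply: contraNneq cab => <-; rewrite !inE eqxx orbT.
  - by apply: contraNneq dab => <-; rewrite !inE eqxx orbT.
  - by apply: contraNneq cab => <-; rewrite !inE eqxx.
  - by apply: contraNneq dab => <-; rewrite !inE eqxx.
have [stB ncB'] := (noncrossingP B).1 ncB.
have gab : g != [set a; b].
  apply/eqP => gE; rewrite gE in gB; apply: (ncB' _ _ gB cdB); apply/crossing_set2.
  by rewrite eq_sym.
have [gcd|gcd] := eqVneq g [set c; d]; first by rewrite gcd setU11.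
rewrite inE in_setD1 gab /= orbC; apply/orP; left.
apply: maximal_add maxA (stB g gB) _ => f fA.
have [->|fab] := eqVneq f [set a; b].
  move=> cr; have [/eqP|/eqP] := diag B g sidesB ncB gB (or_introl cr).
    by rewrite (negPf gab).
  by rewrite (negPf gcd).
by apply: ncB' => //; apply: (subsetP AB); rewrite inE in_setD1 fab fA orbT.
Qed.
End Connectivity.

(** * Connectivity of the flip graph *)

Lemma set2_eq (T : finType) (u v c d : T) : [set u; v] = [set c; d] ->
  (u = c /\ v = d) \/ (u = d /\ v = c).
Proof.
move=> e.
have : (c \in [set u; v]) && (d \in [set u; v]) by rewrite e !inE !eqxx orbT.
have : (u \in [set c; d]) && (v \in [set c; d]) by rewrite -e !inE !eqxx orbT.
rewrite !inE => /andP[/orP[]/eqP-> /orP[]/eqP->] /andP[/orP[]/eqP hc /orP[]/eqP hd];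
  by [left; split; congruence|right; split; congruence].
Qed.

Section FlipGraph.
Variables (R : realType) (n : nat).
Local Notation T := ('I_n * 'I_n)%type.
Local Notation pos := (@lattice_pos R n).
Local Notation D := (standard_edges n).
Implicit Types (a b c d u v r : T) (e f g : {set T}).

Lemma int_lt1 (k : int) : -1 < (k%:~R : R) < 1 -> k = 0.
Proof. by rewrite -[-1]/((-1)%:~R) -[1]/(1%:~R) !ltr_int; lia. Qed.

Lemma standard_edgesP e : reflect
  (exists a b, vec a b \in [:: (1, 0); (0, 1); (1, 1)] /\ e = [set a; b]) (e \in D).
Proof.
rewrite inE; apply: (iffP existsP) => [[a /existsP[b /andP[ab /eqP->]]]|[a [b [ab ->]]]].
  by exists a, b.
by exists a; apply/existsP; exists b; rewrite ab eqxx.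
Qed.

(** Along a standard edge every coordinate is constant or runs between two
    consecutive integers, so at a common point of two edges the lower left ends
    agree. *)
Lemma standard_noncrossing : noncrossing pos D.
Proof.
apply/noncrossingP; split=> [e|e f].
  case/standard_edgesP=> a [b [ab ->]]; apply/straight_edgeP; exists a, b; split=> // [|r].
    by apply: contraTneq ab => ->; rewrite vecaa.
  rewrite (pos_frame R a b) (pos_frame R a r); move: (vec a b) (vec a r) ab => v w vP.
  case=> s s01 []; rewrite /frame /rvec /ipt /= => e1 e2.
  have {}e1 : w.1%:~R = s * v.1%:~R by move: e1; clear; lra.
  have {}e2 : w.2%:~R = s * v.2%:~R by move: e2; clear; lra.
  have no (k l : int) : k%:~R = s * l%:~R -> l = 1 -> False.
    move=> ek h; have k0 : k = 0 by apply: int_lt1; rewrite ek h mulr1z; move: s01; clear; lra.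
    by move: ek s01; rewrite k0 h mulr0z mulr1z; clear; lra.
  by move: vP (no _ _ e1) (no _ _ e2); rewrite !inE => /or3P[]/eqP-> /= h1 h2; first [exact: h1|exact: h2].
case/standard_edgesP=> a [a' [va ->]] /standard_edgesP[b [b' [vb ->]]].
move=> /crossing_set2[/eqP ne [x [[s s01 xs] [t t01 xt]]]]; apply: ne.
have {xs xt} [e1 e2] : (vec a b).1%:~R = s * (vec a a').1%:~R - t * (vec b b').1%:~R /\
    (vec a b).2%:~R = s * (vec a a').2%:~R - t * (vec b b').2%:~R.
  move: xt; rewrite xs (pos_frame R a a') (pos_frame R b b') (pos_frame R a b).
  move: (pos a) (vec a a') (vec b b') (vec a b) => p v w z; clear.
  by rewrite /frame /rvec /ipt /= => -[e1 e2]; split; [move: e1|move: e2]; clear; lra.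
have ends (w : int * int) : w \in [:: (1, 0); (0, 1); (1, 1)] ->
    (w.1 = 0 \/ w.1 = 1) /\ (w.2 = 0 \/ w.2 = 1).
  by rewrite !inE => /or3P[]/eqP->; split; first [by left|by right].
have [[va1 va2] [vb1 vb2]] := (ends _ va, ends _ vb).
have k1 : (vec a b).1 = 0.
  by apply: int_lt1; rewrite e1; case: va1 => ->; case: vb1 => ->; rewrite ?mulr0z ?mulr1z;
    move: s01 t01; clear; lra.
have k2 : (vec a b).2 = 0.
  by apply: int_lt1; rewrite e2; case: va2 => ->; case: vb2 => ->; rewrite ?mulr0z ?mulr1z;
    move: s01 t01; clear; lra.
have ab : a = b by apply: (@vec_inj _ a); rewrite vecaa [RHS]surjective_pairing k1 k2.
rewrite k1 mulr0z in e1; rewrite k2 mulr0z in e2.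
rewrite -{}ab in vb vb1 vb2 e1 e2 *; congr [set _; _].
apply: (@vec_inj _ a); rewrite [LHS]surjective_pairing [RHS]surjective_pairing.
congr (_, _).
  by move: e1; case: va1 => ->; case: vb1 => -> //; rewrite ?mulr0z ?mulr1z; clear -s01 t01 => ?; exfalso; lra.
by move: e2; case: va2 => ->; case: vb2 => -> //; rewrite ?mulr0z ?mulr1z; clear -s01 t01 => ?; exfalso; lra.
Qed.

Definition tri := lattice_triangulation R n.

Lemma triangulationP (X : tri) : maxset (noncrossing pos) (val X).
Proof. exact: (valP X). Qed.

Definition total_weight (A : {set {set T}}) : nat := \sum_(e in A) weight e.

(** Shortening flips lead from any triangulation to the standard one, so a
    property of the standard triangulation that can be pulled back along such
    flips holds for all triangulations.  The hypothesis of [P D] lets this be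
    used before [D] is known to be a triangulation. *)
Lemma triangulation_reduction (P : {set {set T}} -> Prop) :
    (maxset (noncrossing pos) D -> P D) ->
    (forall (X Y : tri) a b c d, flip X Y -> flip Y X ->
       vec a b = ((vec a c).1 + (vec a d).1, (vec a c).2 + (vec a d).2) ->
       [set a; b] \in val X -> [set c; d] \notin val X ->
       val Y = [set c; d] |: val X :\ [set a; b] -> P (val Y) -> P (val X)) ->
  forall X : tri, P (val X).
Proof.
move=> PD step X; have [k] := ubnP (total_weight (val X)).
elim: k X => // k IH X; rewrite ltnS => Xk.
have maxX := triangulationP X.
have [XD|XD] := eqVneq (val X) D; first by rewrite XD; apply: PD; rewrite -XD.
have [a [b [c [d [vab abX cdX wlt maxY]]]]] := shortening_flip maxX XD standard_noncrossing.
pose Y : tri := Sub _ maxY.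
have YE : val Y = [set c; d] |: val X :\ [set a; b] by [].
have neq : [set c; d] != [set a; b] by apply: contraNneq cdX => ->.
have XY : val X :\: val Y = [set [set a; b]].
  apply/setP => e; rewrite YE !inE negb_or negb_and negbK.
  have [->|ne] := eqVneq e [set a; b]; first by rewrite abX eq_sym neq.
  by case: (e \in val X); rewrite ?andbF //= andbF.
have YX : val Y :\: val X = [set [set c; d]].
  apply/setP => e; rewrite YE !inE.
  by have [->|ne] := eqVneq e [set c; d]; [rewrite cdX|case: (e \in val X); rewrite ?andbF].
apply: (step X Y a b c d) => //.
- by rewrite /flip XY YX !cards1.
- by rewrite /flip XY YX !cards1.
apply: IH; apply: leq_trans Xk; rewrite YE /total_weight.
rewrite big_setU1 ?inE ?negb_and ?(negPf cdX) ?orbT //=.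
by rewrite (big_setD1 [set a; b] abX) /= ltn_add2r.
Qed.

Lemma standard_maximal : maxset (noncrossing pos) D.
Proof.
have [A maxA _] := maxset_exists standard_noncrossing.
exact: (@triangulation_reduction (fun=> maxset (noncrossing pos) D) _ _ (Sub A maxA : tri)).
Qed.

Definition standard_triangulation : tri := Sub D standard_maximal.

Lemma lattice_flip_sym : symmetric (@lattice_flip R n).
Proof. by move=> X Y; rewrite /lattice_flip /flip andbC. Qed.

Lemma lattice_flip_connected (X Y : tri) : connect (@lattice_flip R n) X Y.
Proof.
have toD (Z : tri) : connect (@lattice_flip R n) Z standard_triangulation.
  apply: (@triangulation_reduction (fun A => forall Z : tri, val Z = A ->
    connect (@lattice_flip R n) Z standard_triangulation)) (erefl (val Z)).
  - by move=> _ {}Z ZD; rewrite (_ : Z = standard_triangulation) //; apply: val_inj.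
  - move=> {}X {}Y a b c d XY _ _ _ _ _ IH {}Z /val_inj ->.
    exact: connect_trans (connect1 XY) (IH _ erefl).
by rewrite (connect_trans (toD X)) // (sym_connect_sym lattice_flip_sym).
Qed.

Lemma card_triangulation (X : tri) : #|val X| = #|D|.
Proof.
apply: (@triangulation_reduction (fun A => #|A| = #|D|)) => // {}X Y a b c d _ _ _ abX cdX -> <-.
by rewrite cardsU1 !inE (negPf cdX) andbF (cardsD1 [set a; b] (val X)) abX.
Qed.

(** The extension of [A] to a triangulation has as many edges as [A]. *)
Lemma maximal_of_card A : noncrossing pos A -> #|A| = #|D| -> maxset (noncrossing pos) A.
Proof.
move=> ncA cardA; have [B maxB AB] := maxset_exists ncA.
have -> : A = B; last by [].
apply/eqP; rewrite eqEcard AB cardA.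
by rewrite -(card_triangulation (Sub B maxB : tri)) leqnn.
Qed.

(** A flip replaces a diagonal of a parallelogram by the other one, which has the
    same midpoint; so it is enough to look at the standard triangulation.  Halving
    [x1] and [x2], down and up, gives the two ends of a standard edge. *)
Lemma midpoint_covered (X : tri) (x1 x2 : nat) :
    (x1.+1 < n.*2)%N -> (x2.+1 < n.*2)%N -> odd x1 || odd x2 ->
  exists a b, [/\ [set a; b] \in val X, (a.1 + b.1 = x1)%N & (a.2 + b.2 = x2)%N].
Proof.
move=> lt1 lt2 odd12.
apply: (@triangulation_reduction (fun A =>
  exists a b, [/\ [set a; b] \in A, (a.1 + b.1 = x1)%N & (a.2 + b.2 = x2)%N])).
- move=> _; have lo x : (x.+1 < n.*2)%N -> (x./2 < n)%N by lia.
  have hi x : (x.+1 < n.*2)%N -> (uphalf x < n)%N by lia.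
  exists (Ordinal (lo _ lt1), Ordinal (lo _ lt2)), (Ordinal (hi _ lt1), Ordinal (hi _ lt2)).
  split; rewrite /= ?uphalf_half 1?addnCA ?addnn ?odd_double_half //.
  apply/standard_edgesP; exists (Ordinal (lo _ lt1), Ordinal (lo _ lt2)), (Ordinal (hi _ lt1), Ordinal (hi _ lt2)).
  split=> //; rewrite /vec /= !uphalf_half !PoszD !addrK.
  by case: (odd x1) (odd x2) odd12 => [] [].
- move=> {}X Y a b c d _ _ vab abX _ ->; case=> [u [v [uvY e1 e2]]].
  case/setU1P: uvY => [uvcd|/setD1P[_ uvX]]; last by exists u, v.
  exists a, b; case: vab => /= h1 h2; split=> //.
    by case: (set2_eq uvcd) => -[eu ev]; move: e1 h1; rewrite eu ev; clear; lia.
  by case: (set2_eq uvcd) => -[eu ev]; move: e2 h2; rewrite eu ev; clear; lia.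
Qed.
End FlipGraph.

(** * Segments near the midpoint of two candidates *)

(** Coordinates are chosen such that two crossing edges with a common midpoint are
    the segments between the unit points of the axes.  Suppose that [c] is below
    the horizontal axis.  The segment meets this axis at a point [(x, 0)] off the
    first edge.  If [1 < x], the segment also contains the reflection of that
    point in the midpoint of [c d], which is left of the vertical axis, and it
    crosses the second edge in between; if [x <= -1], it does so between [(x, 0)]
    and its midpoint. *)
Lemma midpoint_quadrant (R : realType) (c d : R * R) :
    0 < c.1 + d.1 <= 1 -> 0 < c.2 + d.2 <= 1 ->
    ~ meet c d (-1, 0) (1, 0) -> ~ meet c d (0, -1) (0, 1) -> ~ open_segment c d (1, 0) ->
  0 <= c.2.
Proof.
move=> s1 s2 n1 n2 no; rewrite leNgt; apply/negP => c2.
have d2 : 0 < d.2 by move: s2 c2; clear; lra.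
have [r r01 e2] : exists2 r : R, 0 < r < 1 & 0 = (1 - r) * c.2 + r * d.2.
  by apply: between_open; rewrite c2 d2.
pose x := (1 - r) * c.1 + r * d.1.
have onx : open_segment c d (x, 0) by exists r; rewrite // e2.
have on_line (l z : R) (s : R) : 0 < l < 1 -> 0 < s < 1 ->
    open_segment c d ((1 - l) * x + l * ((1 - s) * c.1 + s * d.1), l * ((1 - s) * c.2 + s * d.2)).
  move=> l01 s01; exists ((1 - l) * r + l * s).
    by move: l01 s01 r01; clear; nra.
  congr (_, _); first by rewrite /x; ring.
  have -> : (1 - ((1 - l) * r + l * s)) * c.2 + ((1 - l) * r + l * s) * d.2 =
     (1 - l) * ((1 - r) * c.2 + r * d.2) + l * ((1 - s) * c.2 + s * d.2) by ring.
  by rewrite -e2 mulr0 add0r.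
have hit (y : R) : open_segment c d (0, y) -> 0 < y < 1 -> False.
  move=> ony y01; apply: n2; exists (0, y); split=> //.
  by exists ((1 + y) / 2); [move: y01; clear; lra|congr (_, _); rewrite /=; field].
have [x1|x1] := ltP x 1; last first.
  have [ex|x1'] := eqVneq x 1; first by apply: no; rewrite -ex.
  have {x1 x1'} x1 : 1 < x by rewrite lt_neqAle eq_sym x1'.
  have [l l01 el] : exists2 l : R, 0 < l < 1 & 0 = (1 - l) * x + l * (c.1 + d.1 - x).
    by apply: between_open; apply/orP; right; move: x1 s1; clear; lra.
  apply: (hit (l * (c.2 + d.2))); last by move: l01 s2; clear; nra.
  have r01' : 0 < 1 - r < 1 by move: r01; clear; lra.
  have := on_line l 0 _ l01 r01'; congr (open_segment _ _ (_, _)).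
    by rewrite [RHS]el /x; ring.
  by rewrite (_ : c.2 + d.2 = (1 - (1 - r)) * c.2 + (1 - r) * d.2) //; move: e2; clear; lra.
have [x0|x0] := ltP (-1) x.
  apply: n1; exists (x, 0); split=> //.
  by exists ((1 + x) / 2); [move: x0 x1; clear; lra|congr (_, _); rewrite /=; field].
have [l l01 el] : exists2 l : R, 0 < l < 1 & 0 = (1 - l) * x + l * ((c.1 + d.1) / 2).
  by apply: between_open; apply/orP; left; move: x0 s1; clear; lra.
apply: (hit (l * ((c.2 + d.2) / 2))); last by move: l01 s2; clear; nra.
have h01 : 0 < (1 / 2 : R) < 1 by lra.
have := on_line l 0 _ l01 h01; congr (open_segment _ _ (_, _)).
  by rewrite [RHS]el; field.
by field.
Qed.

Lemma midpoint_quadrants (R : realType) (c d : R * R) :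
    0 < c.1 + d.1 <= 1 -> 0 < c.2 + d.2 <= 1 ->
    ~ meet c d (-1, 0) (1, 0) -> ~ meet c d (0, -1) (0, 1) ->
    ~ open_segment c d (1, 0) -> ~ open_segment c d (0, 1) ->
  [/\ 0 <= c.1, 0 <= d.1, 0 <= c.2 & 0 <= d.2].
Proof.
move=> s1 s2 n1 n2 no1 no2.
have swap (x : R * R) : (x.2, x.1) = frame (0, 0) (0, 1) (1, 0) x.
  by rewrite /frame /=; congr (_, _); ring.
have det0 : det (0, 1) (1, 0 : R) != 0 by rewrite /det /= mul0r mulr1 sub0r oppr_eq0 oner_eq0.
have swap_meet (x y z t : R * R) : meet (x.2, x.1) (y.2, y.1) (z.2, z.1) (t.2, t.1) -> meet x y z t.
  by rewrite !swap meet_frame.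
have swap_open (x y z : R * R) : open_segment (x.2, x.1) (y.2, y.1) (z.2, z.1) -> open_segment x y z.
  by rewrite !swap open_segment_frame.
have [t1 t2] : 0 < d.1 + c.1 <= 1 /\ 0 < d.2 + c.2 <= 1 by rewrite addrC s1 addrC s2.
split; last 1 first.
- by apply: (@midpoint_quadrant _ d c) => //; [move/meet_swapl|move/meet_swapl|rewrite open_segmentC].
- apply: (@midpoint_quadrant _ (c.2, c.1) (d.2, d.1)) => //.
  + by move/(@swap_meet c d (0, -1) (0, 1)).
  + by move/(@swap_meet c d (-1, 0) (1, 0)).
  + by move/(@swap_open c d (0, 1)).
- apply: (@midpoint_quadrant _ (d.2, d.1) (c.2, c.1)) => //.
  + by move/(@swap_meet d c (0, -1) (0, 1))/meet_swapl.
  + by move/(@swap_meet d c (-1, 0) (1, 0))/meet_swapl.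
  + by move/(@swap_open d c (0, 1)); rewrite open_segmentC.
- exact: (@midpoint_quadrant _ c d).
Qed.

Section Midpoints.
Variables (R : realType) (n : nat).
Local Notation T := ('I_n * 'I_n)%type.
Local Notation pos := (@lattice_pos R n).
Implicit Types (a b c d u v r : T).

(** Twice the displacement from the midpoint of [a b] to [c]. *)
Definition mvec a b c : int * int := ((vec a c).1 + (vec b c).1, (vec a c).2 + (vec b c).2).

Definition same_sum a b c d := mvec a b c = (- (mvec a b d).1, - (mvec a b d).2).

(** The coordinates of [midpoint_quadrants]: the origin is the common midpoint and
    the axes are along the two edges, whose half lengths are the units. *)
Lemma mid_frame a b a' b' : same_sum a b a' b' -> idet (vec a b) (vec a' b') != 0 ->
  let Dl := (idet (vec a b) (vec a' b'))%:~R : R in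
  exists o e w, [/\ det e w != 0, pos a = frame o e w (-1, 0), pos b = frame o e w (1, 0),
      pos a' = frame o e w (0, -1) /\ pos b' = frame o e w (0, 1)
    & forall c, pos c = frame o e w
        ((idet (mvec a b c) (vec a' b'))%:~R / Dl, (idet (vec a b) (mvec a b c))%:~R / Dl)].
Proof.
move=> ss D0 Dl.
pose o := (((pos a).1 + (pos b).1) / 2, ((pos a).2 + (pos b).2) / 2).
pose e : R * R := ((vec a b).1%:~R / 2, (vec a b).2%:~R / 2).
pose w : R * R := ((vec a' b').1%:~R / 2, (vec a' b').2%:~R / 2).
exists o, e, w.
have Dl0 : Dl != 0 by rewrite intr_eq0.
have posc c : pos c = (o.1 + (mvec a b c).1%:~R / 2, o.2 + (mvec a b c).2%:~R / 2).
  rewrite /o (pos_frame R a b) (pos_frame R a c) /mvec.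
  have -> : vec b c = ((vec a c).1 - (vec a b).1, (vec a c).2 - (vec a b).2).
    by rewrite /vec /=; congr (_, _); ring.
  move: (vec a c) (vec a b) (pos a) => z y p; rewrite /frame /rvec /ipt /=.
  by rewrite !rmorphD !rmorphN /=; congr (_, _); field.
have DlE : Dl = (vec a b).1%:~R * (vec a' b').2%:~R - (vec a b).2%:~R * (vec a' b').1%:~R.
  by rewrite /Dl /idet rmorphB !rmorphM.
have posF c : pos c = frame o e w
   ((idet (mvec a b c) (vec a' b'))%:~R / Dl, (idet (vec a b) (mvec a b c))%:~R / Dl).
  rewrite posc /frame /e /w /idet; move: Dl0; rewrite DlE.
  move: o.1 o.2 (mvec a b c) (vec a b) (vec a' b') => p q z y x Dl0.
  by rewrite !rmorphB !rmorphM /=; congr (_, _); field.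
have ma : mvec a b a = (- (vec a b).1, - (vec a b).2).
  by rewrite /mvec vecaa (vecN a b) /= !add0r.
have mb : mvec a b b = vec a b by rewrite /mvec vecaa !addr0 -surjective_pairing.
have ma' : mvec a b a' = (- (vec a' b').1, - (vec a' b').2).
  by move: ss; rewrite /same_sum /mvec /vec /= => -[h1 h2]; congr (_, _); move: h1 h2; clear; lia.
have mb' : mvec a b b' = vec a' b'.
  by move: ss; rewrite /same_sum /mvec /vec /= => -[h1 h2]; congr (_, _); move: h1 h2; clear; lia.
have idetN1 x y : idet (- x.1, - x.2) y = - idet x y by rewrite /idet /=; ring.
have idetN2 x y : idet x (- y.1, - y.2) = - idet x y by rewrite /idet /=; ring.
have idetxx x : idet x x = 0 by rewrite /idet; ring.
split.
- have -> : det e w = Dl / 4.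
    by rewrite DlE /det /e /w; move: (vec a b) (vec a' b') => y x /=; field.
  by rewrite mulf_neq0 // invr_eq0 pnatr_eq0.
- by rewrite (posF a) ma idetN1 idetN2 idetxx oppr0 rmorphN /= mulNr divff // mulr0z mul0r.
- by rewrite (posF b) mb idetxx divff // mulr0z mul0r.
- split; first by rewrite (posF a') ma' idetN1 idetN2 idetxx oppr0 rmorphN /= mulNr divff // mulr0z mul0r.
  by rewrite (posF b') mb' idetxx divff // mulr0z mul0r.
- exact: posF.
Qed.

Lemma mvecC a b c : mvec b a c = mvec a b c.
Proof. by rewrite /mvec; congr (_, _); exact: addrC. Qed.

Lemma quadrant_step a b a' b' c d :
    same_sum a b a' b' -> idet (vec a b) (vec a' b') != 0 ->
    (forall r, ~ open_segment (pos c) (pos d) (pos r)) ->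
    ~ meet (pos c) (pos d) (pos a) (pos b) -> ~ meet (pos c) (pos d) (pos a') (pos b') ->
    let Dl := idet (vec a b) (vec a' b') in
    let al := idet (mvec a b c) (vec a' b') + idet (mvec a b d) (vec a' b') in
    let be := idet (vec a b) (mvec a b c) + idet (vec a b) (mvec a b d) in
    0 < al * Dl -> 0 < be * Dl -> `|al| <= `|Dl| -> `|be| <= `|Dl| ->
  [/\ 0 <= idet (mvec a b c) (vec a' b') * Dl, 0 <= idet (mvec a b d) (vec a' b') * Dl,
      0 <= idet (vec a b) (mvec a b c) * Dl & 0 <= idet (vec a b) (mvec a b d) * Dl].
Proof.
move=> ss D0 st n1 n2 Dl al be al0 be0 al1 be1.
have [z0 [e [w [det0 ea eb [ea' eb'] posF]]]] := mid_frame ss D0.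
set DR : R := (idet _ _)%:~R in posF.
have DR0 : DR != 0 by rewrite intr_eq0.
have quot (x y : int) : 0 < (x + y) * Dl -> `|x + y| <= `|Dl| ->
    0 < (x%:~R / DR + y%:~R / DR : R) <= 1.
  move=> p1 p2; rewrite -mulrDl -rmorphD /=; have D2 : 0 < DR ^+ 2 by rewrite exprn_even_gt0.
  rewrite -(pmulr_lgt0 _ D2).
  have -> : (x + y)%:~R / DR * DR ^+ 2 = ((x + y) * Dl)%:~R by rewrite rmorphM /=; field.
  rewrite ltr0z p1 /=; apply: le_trans (ler_norm _) _.
  by rewrite normrM normfV ler_pdivrMr ?normr_gt0 // mul1r -!intr_norm ler_int.
have sgn (x : int) : 0 <= (x%:~R / DR : R) -> 0 <= x * Dl.
  have D2 : 0 < DR ^+ 2 by rewrite exprn_even_gt0.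
  rewrite -(pmulr_lge0 _ D2).
  have -> : x%:~R / DR * DR ^+ 2 = (x * Dl)%:~R by rewrite rmorphM /=; field.
  by rewrite ler0z.
have [ec ed] := (posF c, posF d).
have q1 := quot _ _ al0 al1; have q2 := quot _ _ be0 be1.
move: n1 n2; rewrite ec ed ea eb ea' eb' !meet_frame // => n1 n2.
have noR : ~ open_segment ((idet (mvec a b c) (vec a' b'))%:~R / DR, (idet (vec a b) (mvec a b c))%:~R / DR)
    ((idet (mvec a b d) (vec a' b'))%:~R / DR, (idet (vec a b) (mvec a b d))%:~R / DR) (1, 0).
  by rewrite -(open_segment_frame z0 _ _ _ det0) -ec -ed -eb; apply: st.
have noU : ~ open_segment ((idet (mvec a b c) (vec a' b'))%:~R / DR, (idet (vec a b) (mvec a b c))%:~R / DR)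
    ((idet (mvec a b d) (vec a' b'))%:~R / DR, (idet (vec a b) (mvec a b d))%:~R / DR) (0, 1).
  by rewrite -(open_segment_frame z0 _ _ _ det0) -ec -ed -eb'; apply: st.
by have [h1 h2 h3 h4] := midpoint_quadrants (c := (_, _)) (d := (_, _)) q1 q2 n1 n2 noR noU; split; apply: sgn.
Qed.

Lemma split_norm (x y D : int) : 0 < (x + y) * D -> 0 <= x * D -> 0 <= y * D ->
  `|x - y| <= `|x + y| /\ (`|x - y| = `|x + y| -> x = 0 \/ y = 0).
Proof. by move=> h1 h2 h3; have [D0|D0|D0] := ltgtP D 0; split; nia. Qed.

Lemma idetNl x y : idet (- x.1, - x.2) y = - idet x y.
Proof. by rewrite /idet /=; ring. Qed.

Lemma idetNr x y : idet x (- y.1, - y.2) = - idet x y.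
Proof. by rewrite /idet /=; ring. Qed.

Lemma same_sumC a b c d : same_sum a b c d -> same_sum c d a b.
Proof. by rewrite /same_sum /mvec /vec /= => -[h1 h2]; congr (_, _); move: h1 h2; clear; lia. Qed.

(** The ends [c] and [d] lie in one closed quadrant, so the coordinates of their
    difference do not exceed those of their sum, with equality only if [c] or [d]
    is on an axis. *)
Lemma quadrant_norms a b a' b' c d :
    same_sum a b a' b' ->
    (forall r, ~ open_segment (pos c) (pos d) (pos r)) ->
    ~ meet (pos c) (pos d) (pos a) (pos b) -> ~ meet (pos c) (pos d) (pos a') (pos b') ->
    let Dl := idet (vec a b) (vec a' b') in
    let xc := idet (mvec a b c) (vec a' b') in let xd := idet (mvec a b d) (vec a' b') in
    let yc := idet (vec a b) (mvec a b c) in let yd := idet (vec a b) (mvec a b d) in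
    xc + xd != 0 -> yc + yd != 0 -> `|xc + xd| <= `|Dl| -> `|yc + yd| <= `|Dl| ->
  [/\ `|xc - xd| <= `|xc + xd|, `|xc - xd| = `|xc + xd| -> xc = 0 \/ xd = 0,
      `|yc - yd| <= `|yc + yd| & `|yc - yd| = `|yc + yd| -> yc = 0 \/ yd = 0].
Proof.
move=> ss st n1 n2.
wlog al0 : a b ss n1 / 0 < (idet (mvec a b c) (vec a' b') + idet (mvec a b d) (vec a' b')) * idet (vec a b) (vec a' b').
  move=> IH Dl xc xd yc yd x0 y0 x1 y1.
  have [p|p] := ltP 0 ((xc + xd) * Dl); first exact: IH.
  have D0 : Dl != 0 by apply: contraNneq x0 => D0; move: x1; rewrite D0 normr0 normr_le0.
  have := IH b a; cbv zeta; rewrite !(mvecC a b) (vecN a b) !idetNl -/xc -/xd -/yc -/yd -/Dl.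
  have -> : - yc - - yd = - (yc - yd) by ring.
  have -> : - yc + - yd = - (yc + yd) by ring.
  rewrite !normrN !oppr_eq0 => H; case: H => // [|||k1 k2 k3 k4].
  - by move: ss; rewrite /same_sum !(mvecC a b).
  - by move/meet_swapr.
  - by rewrite mulrN oppr_gt0 lt_neqAle p mulf_neq0.
  split=> // /k4[]/eqP; rewrite oppr_eq0 => /eqP; by [left|right].
wlog be0 : a' b' ss n2 al0 / 0 < (idet (vec a b) (mvec a b c) + idet (vec a b) (mvec a b d)) * idet (vec a b) (vec a' b').
  move=> IH Dl xc xd yc yd x0 y0 x1 y1.
  have [p|p] := ltP 0 ((yc + yd) * Dl); first exact: IH.
  have D0 : Dl != 0 by apply: contraNneq x0 => D0; move: x1; rewrite D0 normr0 normr_le0.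
  have := IH b' a'; cbv zeta; rewrite (vecN a' b') !idetNr -/xc -/xd -/yc -/yd -/Dl.
  have -> : - xc - - xd = - (xc - xd) by ring.
  have -> : - xc + - xd = - (xc + xd) by ring.
  rewrite !normrN !oppr_eq0 !mulrNN => H; case: H => // [|||k1 k2 k3 k4].
  - by apply: same_sumC; move/same_sumC: ss; rewrite /same_sum !(mvecC a' b').
  - by move/meet_swapr.
  - by rewrite mulrN oppr_gt0 lt_neqAle p mulf_neq0.
  split=> // /k2[]/eqP; rewrite oppr_eq0 => /eqP; by [left|right].
move=> Dl xc xd yc yd x0 y0 x1 y1.
have D0 : Dl != 0 by apply: contraNneq x0 => D0; move: x1; rewrite D0 normr0 normr_le0.
have [h1 h2 h3 h4] := quadrant_step ss D0 st n1 n2 al0 be0 x1 y1.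
have [k1 k2] := split_norm al0 h1 h2.
by have [k3 k4] := split_norm be0 h3 h4.
Qed.

End Midpoints.

(** * Three edges with a common midpoint *)

Lemma vertical_axis_open (R : realType) (z : R) : -1 < z < 1 -> open_segment (0, -1) (0, 1) (0, z).
Proof. by exists ((1 + z) / 2); [lra|congr (_, _); rewrite /=; field]. Qed.

Lemma horizontal_axis_open (R : realType) (z : R) : -1 < z < 1 -> open_segment (-1, 0) (1, 0) (z, 0).
Proof. by exists ((1 + z) / 2); [lra|congr (_, _); rewrite /=; field]. Qed.

Lemma midpoint_open (R : realType) (c d : R * R) : open_segment c d ((c.1 + d.1) / 2, (c.2 + d.2) / 2).
Proof. by exists (1 / 2); [lra|congr (_, _); field]. Qed.

Section TwoCandidates.
Variables (R : realType) (n : nat).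
Local Notation T := ('I_n * 'I_n)%type.
Local Notation pos := (@lattice_pos R n).
Implicit Types (a b c d u v r : T).

Definition oddz (z : int) : Prop := exists k, z = 2 * k + 1.

Section Axes.
Variables a b a' b' : T.
Hypothesis ss : same_sum a b a' b'.
Hypothesis D0 : idet (vec a b) (vec a' b') != 0.
Local Notation Dl := (idet (vec a b) (vec a' b')).
Local Notation xx c := (idet (mvec a b c) (vec a' b')).
Local Notation yy c := (idet (vec a b) (mvec a b c)).

Lemma intr_ratio_lt1 (x : int) : `|x| < `|Dl| -> -1 < (x%:~R / Dl%:~R : R) < 1.
Proof.
move=> xD; rewrite -ltr_norml normrM normfV -!intr_norm ltr_pdivrMr ?mul1r ?ltr_int //.
by rewrite ltr0z normr_gt0.
Qed.

(** If the midpoint of [c d] is on one of the two edges, then [c d] meets that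
    edge. *)
Lemma on_axis_meet c d :
  (xx c + xx d = 0 -> `|yy c + yy d| <= `|Dl| -> meet (pos c) (pos d) (pos a') (pos b')) /\
  (yy c + yy d = 0 -> `|xx c + xx d| <= `|Dl| -> meet (pos c) (pos d) (pos a) (pos b)).
Proof.
have [z0 [e [w [det0 ea eb [ea' eb'] posF]]]] := mid_frame R ss D0.
have half (x y : int) : `|x + y| <= `|Dl| -> -1 < ((x%:~R / Dl%:~R + y%:~R / Dl%:~R) / 2 : R) < 1.
  rewrite -mulrDl -rmorphD /= => xD; have : `|(x + y)%:~R / Dl%:~R : R| <= 1.
    rewrite normrM normfV -!intr_norm ler_pdivrMr ?mul1r ?ler_int //.
    by rewrite ltr0z normr_gt0.
  by rewrite ler_norml; lra.
have zero (x y : int) : x + y = 0 -> (x%:~R / Dl%:~R + y%:~R / Dl%:~R : R) / 2 = 0.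
  by rewrite -mulrDl -rmorphD /= => ->; rewrite mulr0z !mul0r.
rewrite (posF c) (posF d) ea eb ea' eb' !meet_frame //.
split=> /zero e0 /half h1.
  by eexists; split; [exact: midpoint_open|rewrite /= e0; apply: vertical_axis_open].
by eexists; split; [exact: midpoint_open|rewrite /= e0; apply: horizontal_axis_open].
Qed.

(** A grid point on the line of one of the two edges is not in its interior. *)
Lemma on_axis_far c :
    (forall r, ~ open_segment (pos a) (pos b) (pos r)) ->
    (forall r, ~ open_segment (pos a') (pos b') (pos r)) ->
  (xx c = 0 -> `|Dl| <= `|yy c|) /\ (yy c = 0 -> `|Dl| <= `|xx c|).
Proof.
move=> st st'; have [z0 [e [w [det0 ea eb [ea' eb'] posF]]]] := mid_frame R ss D0.
have [sc sc'] := (st c, st' c).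
split=> e0; rewrite leNgt; apply/negP => /intr_ratio_lt1 z1.
  by apply: sc'; rewrite (posF c) ea' eb' open_segment_frame // e0 mulr0z mul0r; apply: vertical_axis_open.
by apply: sc; rewrite (posF c) ea eb open_segment_frame // e0 mulr0z mul0r; apply: horizontal_axis_open.
Qed.

(** Let [P], [Q] be the vectors of the edges [a b] and [a' b'].  By hypothesis,
    any short [v] with [idet v P] odd yields an edge [c d] whose midpoint is at
    [v / 2] or [- v / 2] from theirs and which crosses neither.  Its vector
    [c - d] is again such a [v], and by [quadrant_norms] it is smaller, unless
    [c] and [d] are on the axes; being no interior points of the edges, they are
    then ends of them, and [v] is [(P + Q) / 2] up to signs.  Descent brings
    every [v] to this case, whose norm is the largest allowed, so there was no
    descent at all. *)
Lemma odd_vectors_at_corners :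
    (forall r, ~ open_segment (pos a) (pos b) (pos r)) ->
    (forall r, ~ open_segment (pos a') (pos b') (pos r)) ->
    (forall v : int * int, oddz (idet v (vec a b)) ->
       2 * `|idet v (vec a' b')| <= `|Dl| -> 2 * `|idet (vec a b) v| <= `|Dl| ->
       exists c d, [/\ forall r, ~ open_segment (pos c) (pos d) (pos r),
         ~ meet (pos c) (pos d) (pos a) (pos b), ~ meet (pos c) (pos d) (pos a') (pos b') &
         exists2 s : int, s = 1 \/ s = -1 &
           (mvec a b c).1 + (mvec a b d).1 = 2 * (s * v.1) /\
           (mvec a b c).2 + (mvec a b d).2 = 2 * (s * v.2)]) ->
  forall v : int * int, oddz (idet v (vec a b)) ->
    2 * `|idet v (vec a' b')| <= `|Dl| -> 2 * `|idet (vec a b) v| <= `|Dl| ->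
  2 * `|idet v (vec a' b')| = `|Dl| /\ 2 * `|idet (vec a b) v| = `|Dl|.
Proof.
move=> st st' blocked v; have [k] := ubnP `|(`|idet v (vec a' b')| + `|idet (vec a b) v|)%R|%N.
elim: k v => // k IH v; rewrite ltnS => vk vodd vx vy.
have [c [d [stcd nab nab' [s s1 [sum1 sum2]]]]] := blocked v vodd vx vy.
have xE : xx c + xx d = 2 * (s * idet v (vec a' b')).
  have -> : xx c + xx d = ((mvec a b c).1 + (mvec a b d).1) * (vec a' b').2 -
     ((mvec a b c).2 + (mvec a b d).2) * (vec a' b').1 by rewrite /idet; ring.
  by rewrite sum1 sum2 /idet; ring.
have yE : yy c + yy d = 2 * (s * idet (vec a b) v).
  have -> : yy c + yy d = (vec a b).1 * ((mvec a b c).2 + (mvec a b d).2)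
     - (vec a b).2 * ((mvec a b c).1 + (mvec a b d).1) by rewrite /idet; ring.
  by rewrite sum1 sum2 /idet; ring.
have ns (z : int) : `|2 * (s * z)| = 2 * `|z| by case: s1 => ->; clear; lia.
have xD : `|xx c + xx d| <= `|Dl| by rewrite xE ns.
have yD : `|yy c + yy d| <= `|Dl| by rewrite yE ns.
have [axm aym] := on_axis_meet c d.
have x0 : xx c + xx d != 0 by apply/eqP => /axm /(_ yD).
have y0 : yy c + yy d != 0 by apply/eqP => /aym /(_ xD).
have [le1 eq1 le2 eq2] := quadrant_norms ss stcd nab nab' x0 y0 xD yD.
have w1 : (vec d c).1 * 2 = (mvec a b c).1 - (mvec a b d).1 by rewrite /mvec /vec /=; ring.
have w2 : (vec d c).2 * 2 = (mvec a b c).2 - (mvec a b d).2 by rewrite /mvec /vec /=; ring.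
have xW : xx c - xx d = 2 * idet (vec d c) (vec a' b').
  have -> : 2 * idet (vec d c) (vec a' b') = ((vec d c).1 * 2) * (vec a' b').2 - ((vec d c).2 * 2) * (vec a' b').1.
    by rewrite /idet; ring.
  by rewrite w1 w2 /idet; ring.
have yW : yy c - yy d = 2 * idet (vec a b) (vec d c).
  have -> : 2 * idet (vec a b) (vec d c) = (vec a b).1 * ((vec d c).2 * 2) - (vec a b).2 * ((vec d c).1 * 2).
    by rewrite /idet; ring.
  by rewrite w1 w2 /idet; ring.
have wx : `|idet (vec d c) (vec a' b')| <= `|idet v (vec a' b')|.
  by move: le1; rewrite xW xE ns; clear; lia.
have wy : `|idet (vec a b) (vec d c)| <= `|idet (vec a b) v|.
  by move: le2; rewrite yW yE ns; clear; lia.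
have [/andP[/eqP ex /eqP ey]|lt] := boolP ((`|xx c - xx d| == `|xx c + xx d|) && (`|yy c - yy d| == `|yy c + yy d|)).
  have [farc farc'] := on_axis_far c st st'; have [fard fard'] := on_axis_far d st st'.
  have D1 : 0 < `|Dl| by rewrite normr_gt0.
  have [xs ys] : `|Dl| <= `|xx c + xx d| /\ `|Dl| <= `|yy c + yy d|.
    case: (eq1 ex) (eq2 ey) => [xc0|xd0] [yc0|yd0].
    - by have := farc xc0; rewrite yc0 normr0 leNgt D1.
    - by rewrite xc0 yd0 add0r addr0 fard' // farc.
    - by rewrite xd0 yc0 add0r addr0 farc' // fard.
    - by have := fard xd0; rewrite yd0 normr0 leNgt D1.
  by move: xs ys; rewrite xE yE !ns => xs ys; split; apply/eqP; rewrite eq_le ?vx ?vy.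
have [||||h1 h2] := IH (vec d c).
- apply: leq_trans vk; move: lt; rewrite xE yE xW yW !ns; move: wx wy; clear.
  by rewrite negb_and; lia.
- case: vodd => q vq.
  have y1 : (vec d c).1 = (mvec a b c).1 - s * v.1 by move: w1 sum1; clear; lia.
  have y2 : (vec d c).2 = (mvec a b c).2 - s * v.2 by move: w2 sum2; clear; lia.
  have m1 : (mvec a b c).1 = 2 * (vec a c).1 - (vec a b).1 by rewrite /mvec /vec /=; ring.
  have m2 : (mvec a b c).2 = 2 * (vec a c).2 - (vec a b).2 by rewrite /mvec /vec /=; ring.
  have -> : idet (vec d c) (vec a b) = 2 * idet (vec a c) (vec a b) - s * (2 * q + 1).
    by rewrite -vq /idet y1 y2 m1 m2; ring.
  by case: s1 => ->; [exists (idet (vec a c) (vec a b) - q - 1)|exists (idet (vec a c) (vec a b) + q)]; ring.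
- by apply: le_trans vx; rewrite ler_pM2l.
- by apply: le_trans vy; rewrite ler_pM2l.
split; apply/eqP; rewrite eq_le.
  by rewrite vx -h1 ler_pM2l.
by rewrite vy -h2 ler_pM2l.
Qed.
End Axes.
End TwoCandidates.

Lemma nearest_multiple (x D : int) : D != 0 -> exists i, 2 * `|x - i * D| <= `|D|.
Proof.
move=> D0; have := divz_eq x D; have := modz_ge0 x D0; have := ltz_mod x D0.
move: (x %/ D)%Z (x %% D)%Z => q r r1 r0 xE.
have [h|h] := leP (2 * r) `|D|; first by exists q; rewrite xE addrC addKr ger0_norm.
exists (q + sgz D); rewrite xE (_ : _ - _ = r - sgz D * D); last by ring.
by case: (sgzP D) D0 => D0 // _; rewrite ?mul1r ?mulN1r; move: h r0 r1 D0; clear; lia.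
Qed.

Section ThreeCandidates.
Variables (R : realType) (n : nat).
Local Notation T := ('I_n * 'I_n)%type.
Local Notation pos := (@lattice_pos R n).
Implicit Types (a b c d r : T).

Definition straight2 a b := forall r, ~ open_segment (pos a) (pos b) (pos r).

(** The hypothesis of [odd_vectors_at_corners].  If [idet v P] is odd, where [P]
    is the vector of [a b], then [v] is congruent neither to 0 nor to [P] modulo
    2, and the points at [v / 2] and [- v / 2] from the midpoint of [a b] are
    midpoints of edges in any triangulation whose grid contains them. *)
Definition shielded a b a' b' := forall v : int * int, oddz (idet v (vec a b)) ->
   2 * `|idet v (vec a' b')| <= `|idet (vec a b) (vec a' b')| ->
   2 * `|idet (vec a b) v| <= `|idet (vec a b) (vec a' b')| ->
   exists c d, [/\ straight2 c d,
     ~ meet (pos c) (pos d) (pos a) (pos b), ~ meet (pos c) (pos d) (pos a') (pos b') &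
     exists2 s : int, s = 1 \/ s = -1 &
       (mvec a b c).1 + (mvec a b d).1 = 2 * (s * v.1) /\
       (mvec a b c).2 + (mvec a b d).2 = 2 * (s * v.2)].

Lemma same_sum_even a b c d : same_sum a b c d ->
  exists t : int * int, vec c d = ((vec a b).1 + 2 * t.1, (vec a b).2 + 2 * t.2).
Proof.
rewrite /same_sum /mvec => -[h1 h2]; exists (vec c a).
by move: h1 h2; rewrite /vec /= => h1 h2; congr (_, _); move: h1 h2; clear; lia.
Qed.

Lemma straight_odd a b : a != b -> straight2 a b -> exists v, oddz (idet v (vec a b)).
Proof.
move=> ab st; have := straight_coprime ab st; move: (vec a b) => [x y] /= cop.
have odd_or (z : int) : oddz z \/ exists k, z = 2 * k.
  have := divz_eq z 2; have := modz_ge0 z (isT : 2 != 0 :> int); have := ltz_mod z (isT : 2 != 0 :> int).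
  move: (z %/ 2)%Z (z %% 2)%Z => q r r1 r0 zE.
  have [r_0|r_1] : r = 0 \/ r = 1 by move: r0 r1; clear; lia.
    by right; exists q; rewrite zE r_0; ring.
  by left; exists q; rewrite zE r_1; ring.
have [yodd|[k yE]] := odd_or y; first by exists (1, 0); rewrite /idet /= mul1r mul0r subr0.
have [[l xE]|[l xE]] := odd_or x; last first.
  have : (2 %| gcdn `|x| `|y|)%N by rewrite dvdn_gcd xE yE !abszM !dvdn_mulr.
  by rewrite (eqP cop).
by exists (0, -1); exists l; rewrite /idet /= xE; ring.
Qed.

(** The vectors [v] with [idet v P] odd form a union of cosets of the lattice
    spanned by [P] and [Q]; by [odd_vectors_at_corners] and reduction to a
    fundamental domain, they form the single coset of [(P + Q) / 2].  Translation
    by [S] maps them to themselves, so [S] is in that lattice; [i] and [j] are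
    its coordinates. *)
Lemma candidates_generate a b a' b' (S : int * int) :
    same_sum a b a' b' -> idet (vec a b) (vec a' b') != 0 -> a != b ->
    straight2 a b -> straight2 a' b' -> shielded a b a' b' ->
    (exists t : int * int, S = ((vec a b).1 + 2 * t.1, (vec a b).2 + 2 * t.2)) ->
  exists i j, idet S (vec a' b') = i * idet (vec a b) (vec a' b') /\
              idet (vec a b) S = j * idet (vec a b) (vec a' b').
Proof.
move=> ss D0 ab st st' sh [t SE].
have [q QE] := same_sum_even ss.
have corner := odd_vectors_at_corners ss D0 st st' sh.
have [v0 v0odd] := straight_odd ab st.
move: (vec a b) (vec a' b') D0 SE QE corner v0odd => P Q D0 SE QE corner v0odd.
have half v : oddz (idet v P) -> exists k l,
    2 * idet v Q = (2 * k + 1) * idet P Q /\ 2 * idet P v = (2 * l + 1) * idet P Q.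
  move=> [m vm].
  have [i iP] := nearest_multiple (idet v Q) D0.
  have [j jP] := nearest_multiple (idet P v) D0.
  pose w : int * int := (v.1 - i * P.1 - j * Q.1, v.2 - i * P.2 - j * Q.2).
  have w1 : idet w Q = idet v Q - i * idet P Q by rewrite /w /idet /=; ring.
  have w2 : idet P w = idet P v - j * idet P Q by rewrite /w /idet /=; ring.
  have wodd : oddz (idet w P).
    exists (m + j * idet P q); rewrite (_ : idet w P = idet v P + j * idet P Q); last by rewrite /w /idet /=; ring.
    by rewrite vm QE /idet /=; ring.
  have := corner w wodd; rewrite w1 w2 => /(_ iP jP) [].
  have sg (x : int) : 2 * `|x| = `|idet P Q| -> 2 * x = idet P Q \/ 2 * x = - idet P Q by clear; lia.
  move=> /sg e1 /sg e2.
  have [k ek] : exists k, 2 * idet v Q = (2 * k + 1) * idet P Q.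
    case: e1 => e1; [exists i|exists (i - 1)].
      by rewrite (_ : 2 * idet v Q = 2 * (idet v Q - i * idet P Q) + 2 * i * idet P Q); [rewrite e1; ring|ring].
    by rewrite (_ : 2 * idet v Q = 2 * (idet v Q - i * idet P Q) + 2 * i * idet P Q); [rewrite e1; ring|ring].
  have [l el] : exists l, 2 * idet P v = (2 * l + 1) * idet P Q.
    case: e2 => e2; [exists j|exists (j - 1)].
      by rewrite (_ : 2 * idet P v = 2 * (idet P v - j * idet P Q) + 2 * j * idet P Q); [rewrite e2; ring|ring].
    by rewrite (_ : 2 * idet P v = 2 * (idet P v - j * idet P Q) + 2 * j * idet P Q); [rewrite e2; ring|ring].
  by exists k, l.
have [k [l [ek el]]] := half _ v0odd.
have vSodd : oddz (idet (v0.1 + S.1, v0.2 + S.2) P).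
  case: v0odd => m vm; exists (m + idet t P).
  rewrite (_ : idet _ P = idet v0 P + idet S P); last by rewrite /idet /=; ring.
  by rewrite vm SE /idet /=; ring.
have [k' [l' [ek' el']]] := half _ vSodd.
have two (x y : int) : 2 * x = 2 * y -> x = y by clear; lia.
exists (k' - k), (l' - l); split; apply: two.
  rewrite (_ : 2 * idet S Q = 2 * idet (v0.1 + S.1, v0.2 + S.2) Q - 2 * idet v0 Q); last by rewrite /idet /=; ring.
  by rewrite ek ek'; ring.
rewrite (_ : 2 * idet P S = 2 * idet P (v0.1 + S.1, v0.2 + S.2) - 2 * idet P v0); last by rewrite /idet /=; ring.
by rewrite el el'; ring.
Qed.

(** Parallel primitive vectors are equal up to sign. *)
Lemma straight_parallel a b a' b' : a != b -> a' != b' -> straight2 a b -> straight2 a' b' ->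
  same_sum a b a' b' -> idet (vec a b) (vec a' b') = 0 -> [set a; b] = [set a'; b'].
Proof.
move=> ab ab' st st' ss D0.
have cop := straight_coprime ab st; have cop' := straight_coprime ab' st'.
have PQ : vec a b = vec a' b' \/ vec a b = (- (vec a' b').1, - (vec a' b').2).
  move: (vec a b) (vec a' b') cop cop' D0 => [x y] [z t]; rewrite /idet /= => cop cop' D0.
  have eN : (`|x| * `|t| = `|y| * `|z|)%N by rewrite -!abszM; congr absz; move: D0; clear; lia.
  have xz : `|x|%N = `|z|%N.
    apply/eqP; rewrite eqn_dvd -(Gauss_dvdr _ cop) -eN dvdn_mulr //=.
    by rewrite -(Gauss_dvdl _ cop') eN dvdn_mull.
  have yt : `|y|%N = `|t|%N.
    apply/eqP; rewrite eqn_dvd -(Gauss_dvdr _ (etrans (coprime_sym _ _) cop)) eN dvdn_mulr //=.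
    by rewrite -(Gauss_dvdr _ (etrans (coprime_sym _ _) cop')) mulnC -eN dvdn_mull.
  have xs : x = z \/ x = - z by move: xz; clear; lia.
  have ys : y = t \/ y = - t by move: yt; clear; lia.
  clear -xs ys D0; case: xs ys D0 => -> [->|->] D0.
  - by left.
  - have /eqP : z * t = 0 by move: D0; clear; lia.
    by rewrite mulf_eq0 => /orP[]/eqP->; rewrite oppr0; [right|left].
  - have /eqP : z * t = 0 by move: D0; clear; lia.
    by rewrite mulf_eq0 => /orP[]/eqP->; rewrite oppr0; [left|right].
  - by right.
have eqv (x y : T) : vec x y = (0, 0) -> x = y by rewrite -(vecaa x) => /vec_inj.
move: ss; rewrite /same_sum /mvec => -[s1 s2]; case: PQ => -[p1 p2].
  have -> : a = a' by apply: eqv; rewrite /vec; congr (_, _); move: s1 s2 p1 p2; clear; lia.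
  have -> // : b = b' by apply: eqv; rewrite /vec; congr (_, _); move: s1 s2 p1 p2; clear; lia.
rewrite [RHS]setUC.
have -> : a = b' by apply: eqv; rewrite /vec; congr (_, _); move: s1 s2 p1 p2; clear; lia.
by have -> // : b = a' by apply: eqv; rewrite /vec; congr (_, _); move: s1 s2 p1 p2; clear; lia.
Qed.

(** Each of the three vectors is an integral combination of the other two, so
    [S] is [P + Q] up to signs.  As the three are congruent modulo 2, [P] would be
    divisible by 2, but it is primitive. *)
Lemma no_three_candidates a1 b1 a2 b2 a3 b3 :
    [/\ a1 != b1, a2 != b2 & a3 != b3] ->
    [/\ straight2 a1 b1, straight2 a2 b2 & straight2 a3 b3] ->
    [/\ same_sum a1 b1 a2 b2, same_sum a1 b1 a3 b3 & same_sum a2 b2 a3 b3] ->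
    [/\ shielded a1 b1 a2 b2, shielded a1 b1 a3 b3 & shielded a2 b2 a3 b3] ->
  [\/ [set a1; b1] = [set a2; b2], [set a1; b1] = [set a3; b3] | [set a2; b2] = [set a3; b3]].
Proof.
move=> [n1 n2 n3] [s1 s2 s3] [e12 e13 e23] [h12 h13 h23].
have [z12|D12] := eqVneq (idet (vec a1 b1) (vec a2 b2)) 0; first by constructor 1; apply: straight_parallel.
have [z13|D13] := eqVneq (idet (vec a1 b1) (vec a3 b3)) 0; first by constructor 2; apply: straight_parallel.
have [z23|D23] := eqVneq (idet (vec a2 b2) (vec a3 b3)) 0; first by constructor 3; apply: straight_parallel.
exfalso.
have even23 := same_sum_even (same_sumC e12).
have [i [j [ei ej]]] := candidates_generate e12 D12 n1 s1 s2 h12 (same_sum_even e13).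
have [_ [j' [_ ej']]] := candidates_generate e13 D13 n1 s1 s3 h13 (same_sum_even e12).
have [_ [l [_ el]]] := candidates_generate e23 D23 n2 s2 s3 h23 even23.
have [t3 P3] := same_sum_even e13; have [t2 P2] := same_sum_even e12.
have [v [k vk]] := straight_odd n1 s1.
clear -D12 D13 ei ej ej' el t3 P3 t2 P2 vk.
move: (vec a1 b1) (vec a2 b2) (vec a3 b3) D12 D13 ei ej ej' el P3 P2 vk => P Q S.
move=> D12 D13 ei ej ej' el P3 P2 vk.
have jj' : j * j' = 1.
  by apply: (mulIf D13); rewrite mul1r {2}ej ej' mulrA [j * _]mulrC.
have il : i * l = 1.
  apply: (mulIf D12); rewrite mul1r mulrAC -ei.
  rewrite (_ : idet S Q * l = - (l * idet Q S)); last by rewrite /idet; ring.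
  by rewrite -el /idet; ring.
have S1 : S.1 = i * P.1 + j * Q.1.
  apply: (mulfI D12); rewrite (_ : _ * S.1 = idet S Q * P.1 + idet P S * Q.1); last by rewrite /idet; ring.
  by rewrite ei ej; ring.
have S2 : S.2 = i * P.2 + j * Q.2.
  apply: (mulfI D12); rewrite (_ : _ * S.2 = idet S Q * P.2 + idet P S * Q.2); last by rewrite /idet; ring.
  by rewrite ei ej; ring.
have par : (1 - i - j) * (2 * k + 1) = 2 * (j * idet v t2 - idet v t3).
  rewrite -vk; move: S1 S2; rewrite P2 P3 /idet /= => S1 S2.
  have -> : (1 - i - j) * (v.1 * P.2 - v.2 * P.1) = v.1 * ((1 - i - j) * P.2) - v.2 * ((1 - i - j) * P.1) by ring.
  have -> : (1 - i - j) * P.2 = 2 * (j * t2.2 - t3.2) by move: S2; clear; lia.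
  have -> : (1 - i - j) * P.1 = 2 * (j * t2.1 - t3.1) by move: S1; clear; lia.
  by ring.
have unit1 (x y : int) : x * y = 1 -> x = 1 \/ x = -1.
  move/(congr1 absz); rewrite abszM => /eqP; rewrite muln_eq1 => /andP[/eqP x1 _].
  by move: x1; clear; lia.
clear -par il jj' unit1.
by case: (unit1 _ _ jj') par => ->; case: (unit1 _ _ il) => ->; clear; lia.
Qed.

End ThreeCandidates.

(** * The number of triangulations is exponential in the area *)

Section Counting.
Variables (R : realType) (n : nat).
Local Notation T := ('I_n * 'I_n)%type.
Local Notation pos := (@lattice_pos R n).
Local Notation tri := (lattice_triangulation R n).
Implicit Types (a b c d r : T) (e f g : {set T}) (X Y : tri).

(** The rank of the midpoint of an edge in the lexicographic order: the sums of
    the second coordinates are less than the factor [n.*2]. *)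
Definition key e : nat := (\sum_(p in e) (n.*2 * p.1 + p.2))%N.

Lemma key_set2 a b : a != b -> key [set a; b] = (n.*2 * (a.1 + b.1) + (a.2 + b.2))%N.
Proof. by move=> ab; rewrite /key big_setU1 ?inE //= big_set1; ring. Qed.

Lemma triangulation_edge X e : e \in val X ->
  exists a b, [/\ e = [set a; b], a != b & straight2 R a b].
Proof.
have /maxsetP[/noncrossingP[st _] _] := triangulationP X.
by move=> /st /straight_edgeP[a [b [-> ab stab]]]; exists a, b.
Qed.

Lemma triangulation_meet X a b c d : [set a; b] \in val X -> [set c; d] \in val X ->
  meet (pos a) (pos b) (pos c) (pos d) -> [set a; b] = [set c; d].
Proof.
have /maxsetP[/noncrossingP[_ nc] _] := triangulationP X.
move=> abX cdX m; apply/eqP/negPn/negP => ne.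
by apply: (nc _ _ abX cdX); apply/crossing_set2.
Qed.

Lemma key_same_sum a b c d : a != b -> c != d -> key [set a; b] = key [set c; d] ->
  (a.1 + b.1 = c.1 + d.1 /\ a.2 + b.2 = c.2 + d.2)%N.
Proof.
move=> ab cd; rewrite !key_set2 //.
have lt (x y : T) : (x.2 + y.2 < n.*2)%N.
  by have := ltn_ord x.2; have := ltn_ord y.2; lia.
have n0 : (0 < n.*2)%N by apply: leq_ltn_trans (lt a b).
move=> e; have e1 := congr1 (fun z => z %/ n.*2)%N e; have e2 := congr1 (fun z => z %% n.*2)%N e.
move: e1 e2; rewrite /= ![(n.*2 * _)%N]mulnC !divnMDl // !modnMDl !divn_small ?modn_small ?lt // !addn0.
by [].
Qed.

Lemma same_sumP a b c d : (a.1 + b.1 = c.1 + d.1 /\ a.2 + b.2 = c.2 + d.2)%N -> same_sum a b c d.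
Proof. by move=> [h1 h2]; rewrite /same_sum /mvec /vec /=; congr (_, _); move: h1 h2; clear; lia. Qed.

Lemma mid_meet a b c d : (a.1 + b.1 = c.1 + d.1 /\ a.2 + b.2 = c.2 + d.2)%N ->
  meet (pos a) (pos b) (pos c) (pos d).
Proof.
move=> [h1 h2]; have halves x y : open_segment (pos x) (pos y) ((x.1 + y.1)%:R / 2 + 1, (x.2 + y.2)%:R / 2 + 1).
  exists (1 / 2); first lra.
  by rewrite /lattice_pos /= -!natr1 !natrD; congr (_, _); field.
exists ((a.1 + b.1)%:R / 2 + 1, (a.2 + b.2)%:R / 2 + 1); split; first exact: halves.
by rewrite h1 h2; apply: halves.
Qed.

Lemma same_key X e f : e \in val X -> f \in val X -> key e = key f -> e = f.
Proof.
move=> eX fX; have [a [b [eE ab _]]] := triangulation_edge eX.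
have [c [d [fE cd _]]] := triangulation_edge fX; subst e f.
by move=> /(key_same_sum ab cd) /mid_meet; apply: triangulation_meet eX fX.
Qed.

(** Midpoints of edges are exactly the half-integral points of the square that are
    not integral, whatever the triangulation. *)
Lemma key_cover X Y e : e \in val X -> exists2 f, f \in val Y & key f = key e.
Proof.
move=> eX; have [a [b [eE ab st]]] := triangulation_edge eX; subst e.
have [c [d [cdY s1 s2]]] : exists c d, [/\ [set c; d] \in val Y, (c.1 + d.1 = a.1 + b.1)%N & (c.2 + d.2 = a.2 + b.2)%N].
  apply: midpoint_covered.
  - by have := ltn_ord a.1; have := ltn_ord b.1; clear; lia.
  - by have := ltn_ord a.2; have := ltn_ord b.2; clear; lia.
  - apply/negPn/negP; rewrite negb_or => /andP[ev1 ev2].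
    have := straight_coprime ab st; rewrite /coprime => /eqP g1.
    have : (2 %| gcdn `|(vec a b).1| `|(vec a b).2|)%N.
      by rewrite dvdn_gcd /vec /=; move: ev1 ev2; clear; lia.
    by rewrite g1.
exists [set c; d] => //.
have [c' [d' [cdE cd _]]] := triangulation_edge cdY.
have {cdE}cd : c != d.
  by apply: contraNneq cd => cd; have := congr1 (fun A : {set T} => #|A|) cdE; rewrite cd setUid cards1 cards2; case: eqP.
by rewrite !key_set2 // s1 s2.
Qed.

(** Of the two points at [v / 2] and [- v / 2] from the common midpoint, one comes
    first in the lexicographic order.  Both are in the square, as they are in the
    convex hull of the two candidates.  The edge of [X] with that midpoint is also
    in [Y], so it crosses neither candidate. *)
Lemma shielded_of_common_lower X Y a b a' b' :
    a != b -> a' != b' -> straight2 R a b -> [set a; b] \in val X -> [set a'; b'] \in val Y ->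
    same_sum a b a' b' -> key [set a; b] = key [set a'; b'] ->
    idet (vec a b) (vec a' b') != 0 ->
    (forall g, (key g < key [set a; b])%N -> g \in val X -> g \in val Y) ->
  shielded R a b a' b'.
Proof.
move=> ab ab' st abX abY ss keyE D0 low v vodd vx vy.
have [q QE] := same_sum_even ss.
have bnd (x p1 p2 al be Dl : int) : Dl != 0 -> Dl * x = al * p1 + be * p2 ->
    2 * `|al| <= `|Dl| -> 2 * `|be| <= `|Dl| -> 2 * `|x| <= `|p1| + `|p2|.
  move=> Dl0 e h1 h2; have Dl1 : 0 < `|Dl| by rewrite normr_gt0.
  rewrite -(ler_pM2l Dl1) mulrCA -normrM e.
  apply: (@le_trans _ _ (2 * (`|al| * `|p1| + `|be| * `|p2|))).
    by rewrite ler_pM2l // -!normrM ler_normD.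
  by rewrite !mulrDr !mulrA lerD // ler_wpM2r.
have v1 : 2 * `|v.1| <= `|(vec a b).1| + `|(vec a' b').1|.
  by apply: (bnd _ _ _ (idet v (vec a' b')) (idet (vec a b) v) _ D0) => //; rewrite /idet; ring.
have v2 : 2 * `|v.2| <= `|(vec a b).2| + `|(vec a' b').2|.
  by apply: (bnd _ _ _ (idet v (vec a' b')) (idet (vec a b) v) _ D0) => //; rewrite /idet; ring.
have [m1E m2E] := key_same_sum ab ab' keyE.
have lim (x y x' y' : 'I_n) (z : int) : (x + y = x' + y')%N ->
    2 * `|z| <= `|y%:Z - x%:Z| + `|y'%:Z - x'%:Z| ->
    `|z| <= (x + y)%:Z /\ (x + y)%:Z + `|z| < (n.*2)%:Z - 1.
  have := ltn_ord x; have := ltn_ord y; have := ltn_ord x'; have := ltn_ord y'.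
  by clear; lia.
have [l1 u1] := lim _ _ _ _ _ m1E v1; have [l2 u2] := lim _ _ _ _ _ m2E v2.
set m1 := (a.1 + b.1)%N in l1 u1; set m2 := (a.2 + b.2)%N in l2 u2.
have w0 : (n.*2)%:Z * v.1 + v.2 != 0.
  apply/eqP => w0; have v10 : v.1 = 0 by move: w0 l2 u2; clear; nia.
  have v20 : v.2 = 0 by move: w0; rewrite v10; clear; lia.
  by case: vodd => k; rewrite /idet v10 v20 !mul0r subr0; clear; lia.
have [s s1 sw] : exists2 s : int, s = 1 \/ s = -1 & s * ((n.*2)%:Z * v.1 + v.2) < 0.
  have [p|p|e0] := ltgtP ((n.*2)%:Z * v.1 + v.2) 0.
  - by exists 1; [left|rewrite mul1r].
  - by exists (-1); [right|rewrite mulN1r oppr_lt0].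
  - by rewrite e0 eqxx in w0.
have sub (m : nat) (z : int) : `|z| <= m%:Z -> m%:Z + `|z| < (n.*2)%:Z - 1 ->
    exists x : nat, x%:Z = m%:Z + s * z /\ (x.+1 < n.*2)%N.
  move=> h1 h2; exists `|(m%:Z + s * z)%R|%N.
  by move: s1 h1 h2 => [] ->; rewrite ?mul1r ?mulN1r; clear; lia.
have [x1 [x1E x1n]] := sub _ _ l1 u1; have [x2 [x2E x2n]] := sub _ _ l2 u2.
have odd12 : odd x1 || odd x2.
  apply/negPn/negP; rewrite negb_or => /andP[ev1 ev2].
  have [y1 y1E] : exists y : int, x1%:Z = 2 * y by exists x1./2%:Z; move: ev1; clear; lia.
  have [y2 y2E] : exists y : int, x2%:Z = 2 * y by exists x2./2%:Z; move: ev2; clear; lia.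
  case: vodd => k vk.
  have ss1 : s * s = 1 by case: s1 => ->.
  have v1E : v.1 = s * (2 * y1 - m1%:Z).
    by rewrite -y1E x1E addrC addKr mulrA ss1 mul1r.
  have v2E : v.2 = s * (2 * y2 - m2%:Z).
    by rewrite -y2E x2E addrC addKr mulrA ss1 mul1r.
  have P1 : (vec a b).1 = m1%:Z - 2 * a.1%:Z by rewrite /vec /m1 PoszD /=; ring.
  have P2 : (vec a b).2 = m2%:Z - 2 * a.2%:Z by rewrite /vec /m2 PoszD /=; ring.
  have : idet v (vec a b) = 2 * (s * (y1 * m2%:Z - 2 * y1 * a.2%:Z + m1%:Z * a.2%:Z
      - y2 * m1%:Z + 2 * y2 * a.1%:Z - m2%:Z * a.1%:Z)).
    by rewrite /idet v1E v2E P1 P2; ring.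
  by rewrite vk; move: (s * _); clear; lia.
have [c [d [cdX c1 c2]]] := midpoint_covered X x1n x2n odd12.
have [c' [d' [cdE cd' stcd']]] := triangulation_edge cdX.
have [cd stcd] : c != d /\ straight2 R c d.
  case: (set2_eq cdE) => -[-> ->] //; split; first by rewrite eq_sym.
  by move=> r; rewrite open_segmentC.
have keylt : (key [set c; d] < key [set a; b])%N.
  rewrite !key_set2 // c1 c2 -/m1 -/m2 -ltz_nat !PoszD !PoszM x1E x2E.
  move: sw; rewrite mulrDr [s * (_ * _)]mulrCA; clear; lia.
have cdY := low _ keylt cdX.
exists c, d; split=> //.
- by move/(triangulation_meet cdX abX) => e; rewrite e ltnn in keylt.
- by move/(triangulation_meet cdY abY) => e; rewrite keyE e ltnn in keylt.
exists s => //; rewrite /mvec /vec /=; move: x1E x2E; rewrite -c1 -c2 /m1 /m2; clear; lia.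
Qed.

Definition lower_part (k : nat) (X : tri) : {set {set T}} := [set e : {set T} in val X | (key e < k)%N].

Lemma lower_partS k X : lower_part k.+1 X =
  lower_part k X :|: [set e : {set T} in val X | key e == k].
Proof. by apply/setP => e; rewrite !inE ltnS leq_eqVlt orbC andb_orr. Qed.

Lemma two_extensions k X Y Z :
    lower_part k X = lower_part k Y -> lower_part k X = lower_part k Z ->
  [\/ lower_part k.+1 X = lower_part k.+1 Y,
      lower_part k.+1 X = lower_part k.+1 Z
    | lower_part k.+1 Y = lower_part k.+1 Z].
Proof.
move=> XY XZ.
have top (W : tri) e : e \in val W -> key e = k -> [set f : {set T} in val W | key f == k] = [set e].
  move=> eW ek; apply/setP => f; rewrite !inE; apply/andP/eqP => [[fW /eqP fk]|-> //].
    by apply: (same_key fW eW); rewrite ek.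
  by rewrite ek.
have [e0|/set0Pn[e]] := eqVneq [set e : {set T} in val X | key e == k] set0.
  have empty (W : tri) : [set e : {set T} in val W | key e == k] = set0.
    apply/eqP; apply: contraT => /set0Pn[e]; rewrite inE => /andP[eW /eqP ek].
    have [f fX fk] := key_cover X eW.
    by have := in_set0 f; rewrite -e0 inE fX fk ek eqxx.
  by constructor 1; rewrite !lower_partS !empty XY.
rewrite inE => /andP[eX /eqP ek].
have [f fY fk] := key_cover Y eX; have [g gZ gk] := key_cover Z eX.
rewrite ek in fk gk.
rewrite !lower_partS (top X e) // (top Y f) // (top Z g) // -XY -XZ.
have low (V W : tri) : lower_part k V = lower_part k W ->
    forall h, (key h < k)%N -> h \in val V -> h \in val W.
  move=> VW h hk hV; have : h \in lower_part k V by rewrite inE hV.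
  by rewrite VW inE => /andP[].
have [a1 [b1 [E1 n1 s1]]] := triangulation_edge eX.
have [a2 [b2 [E2 n2 s2]]] := triangulation_edge fY.
have [a3 [b3 [E3 n3 s3]]] := triangulation_edge gZ.
subst e f g.
have e12 := same_sumP (key_same_sum n1 n2 (etrans ek (esym fk))).
have e13 := same_sumP (key_same_sum n1 n3 (etrans ek (esym gk))).
have e23 := same_sumP (key_same_sum n2 n3 (etrans fk (esym gk))).
have [z12|D12] := eqVneq (idet (vec a1 b1) (vec a2 b2)) 0.
  by constructor 1; rewrite (straight_parallel n1 n2 s1 s2 e12 z12).
have [z13|D13] := eqVneq (idet (vec a1 b1) (vec a3 b3)) 0.
  by constructor 2; rewrite (straight_parallel n1 n3 s1 s3 e13 z13).
have [z23|D23] := eqVneq (idet (vec a2 b2) (vec a3 b3)) 0.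
  by constructor 3; rewrite (straight_parallel n2 n3 s2 s3 e23 z23).
have h12 : shielded R a1 b1 a2 b2.
  by apply: (shielded_of_common_lower n1 n2 s1 eX fY); rewrite ?ek ?fk // => h; apply: low.
have h13 : shielded R a1 b1 a3 b3.
  by apply: (shielded_of_common_lower n1 n3 s1 eX gZ); rewrite ?ek ?gk // => h; apply: low.
have h23 : shielded R a2 b2 a3 b3.
  by apply: (shielded_of_common_lower n2 n3 s2 fY gZ); rewrite ?fk ?gk // => h; apply: low; rewrite -XY.
have [->|->|->] := no_three_candidates (And3 n1 n2 n3) (And3 s1 s2 s3) (And3 e12 e13 e23) (And3 h12 h13 h23).
- by constructor 1.
- by constructor 2.
- by constructor 3.
Qed.

Lemma card_lower_parts k : (#|[set lower_part k X | X : tri]| <= 2 ^ k)%N.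
Proof.
elim: k => [|k IH].
  apply: (@leq_trans #|[set (set0 : {set {set T}})]|); last by rewrite cards1.
  apply/subset_leq_card/subsetP => _ /imsetP[X _ ->].
  by rewrite inE; apply/eqP/setP => e; rewrite !inE andbF.
pose cut (A : {set {set T}}) := [set e in A | (key e < k)%N].
have cutE X : cut (lower_part k.+1 X) = lower_part k X.
  apply/setP => e; rewrite !inE -andbA; congr (_ && _).
  by rewrite andb_idl // => /ltnW.
rewrite -sum1_card (partition_big cut (mem [set lower_part k X | X : tri])) /=; last first.
  by move=> _ /imsetP[X _ ->]; rewrite cutE imset_f.
rewrite expnS mulnC; apply: leq_trans (leq_mul IH (leqnn 2)).
rewrite -sum_nat_const; apply: leq_sum => _ /imsetP[W _ ->].
rewrite sum1dep_card leqNgt; apply/negP => /card_gt2P[A [B [C []]]].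
rewrite !inE => -[/andP[/imsetP[X _ ->] /eqP cX] /andP[/imsetP[Y _ ->] /eqP cY] /andP[/imsetP[Z _ ->] /eqP cZ]].
case; move: cX cY cZ; rewrite !cutE => cX cY cZ.
have [->|->|->] := two_extensions (etrans cX (esym cY)) (etrans cX (esym cZ)); rewrite ?eqxx //.
Qed.

(** Adding the edges in the order of their midpoints, there are at most two
    choices at each step. *)
Theorem card_triangulations_le : (#|{: tri}| <= 2 ^ (n.*2 * n.*2))%N.
Proof.
apply: leq_trans (card_lower_parts _).
rewrite card_in_imset // => X Y _ _ e; apply: val_inj.
have all (W : tri) : lower_part (n.*2 * n.*2) W = val W.
  apply/setP => f; rewrite inE; apply/andb_idr => fW.
  have [a [b [-> ab _]]] := triangulation_edge fW; rewrite key_set2 //.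
  have := ltn_ord a.1; have := ltn_ord b.1; have := ltn_ord a.2; have := ltn_ord b.2.
  by clear; nia.
by rewrite -(all X) -(all Y).
Qed.

End Counting.

(** * Gluing triangulations of blocks *)

Section Blocks.
Variables (R : realType) (m d n : nat).
Hypothesis fits : (d * m <= n)%N.
Local Notation B := ('I_m * 'I_m)%type.
Local Notation T := ('I_n * 'I_n)%type.
Local Notation posB := (@lattice_pos R m).
Local Notation pos := (@lattice_pos R n).
Local Notation triB := (lattice_triangulation R m).
Local Notation tri := (lattice_triangulation R n).

Lemma block_row_lt (i : 'I_(d * d)) : (i %/ d < d)%N.
Proof. by move: (nat_of_ord i) (ltn_ord i); case: d => [|d'] // k; rewrite ltn_divLR. Qed.

Lemma block_col_lt (i : 'I_(d * d)) : (i %% d < d)%N.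
Proof. by move: (nat_of_ord i) (ltn_ord i); case: d => [|d'] // k; rewrite ltn_mod. Qed.

Lemma block_coordinate_lt (q : nat) (x : 'I_m) : (q < d)%N -> (m * q + x < n)%N.
Proof.
move=> qd; apply: leq_trans fits; apply: (@leq_trans (m * q.+1)).
  by rewrite mulnS addnC ltn_add2r ltn_ord.
by rewrite mulnC leq_mul2r qd orbT.
Qed.

(** The blocks are [d * d] disjoint squares of [m * m] points, in [d] rows; strips
    of unit squares remain between them. *)
Definition embed (i : 'I_(d * d)) (p : B) : T :=
  (Ordinal (block_coordinate_lt p.1 (block_row_lt i)),
   Ordinal (block_coordinate_lt p.2 (block_col_lt i))).

Lemma vec_embed i p q : vec (embed i p) (embed i q) = vec p q.
Proof. by rewrite /vec /= !PoszD; congr (_, _); ring. Qed.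

Lemma block_eq (q q' x y : nat) : (x < m)%N -> (y < m)%N -> (m * q + x = m * q' + y)%N -> q = q'.
Proof.
move=> xm ym e; have m0 : (0 < m)%N by apply: leq_trans xm.
by have := congr1 (divn^~ m) e; rewrite /= ![(m * _)%N]mulnC !divnMDl // !divn_small // !addn0.
Qed.

Lemma embed_inj i p j q : embed i p = embed j q -> i = j /\ p = q.
Proof.
case=> e1 e2.
have r := block_eq (ltn_ord _) (ltn_ord _) e1; have c := block_eq (ltn_ord _) (ltn_ord _) e2.
have ij : i = j by apply: val_inj; rewrite /= (divn_eq i d) (divn_eq j d) r c.
split=> //; move: e1 e2; rewrite -ij => /addnI /val_inj e1 /addnI /val_inj e2.
by rewrite [p]surjective_pairing e1 e2 -surjective_pairing.
Qed.

Definition block_frame (i : 'I_(d * d)) (x : R * R) : R * R :=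
  frame ((m * (i %/ d))%:R, (m * (i %% d))%:R) (1, 0) (0, 1) x.

Lemma pos_embed i p : pos (embed i p) = block_frame i (posB p).
Proof.
by rewrite /block_frame /frame /lattice_pos /=; congr (_, _);
  rewrite -!natr1 !natrD; ring.
Qed.

Lemma det_unit : det (1, 0) (0, 1 : R) != 0.
Proof. by rewrite /det /= mulr1 mulr0 subr0 oner_eq0. Qed.

Definition in_square (i : 'I_(d * d)) (x : R * R) : Prop :=
  ((m * (i %/ d)).+1%:R <= x.1 <= (m * (i %/ d) + m)%:R) /\
  ((m * (i %% d)).+1%:R <= x.2 <= (m * (i %% d) + m)%:R).

Lemma segment_in_square i p q x :
  open_segment (pos (embed i p)) (pos (embed i q)) x -> in_square i x.
Proof.
have ends (k : nat) (y : 'I_m) : (m * k).+1%:R <= ((m * k + y).+1%:R : R) <= (m * k + m)%:R.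
  by rewrite !ler_nat ltnS leq_addr -addnS leq_add2l ltn_ord.
have conv (l h u v s : R) : 0 < s < 1 -> l <= u <= h -> l <= v <= h -> l <= (1 - s) * u + s * v <= h.
  by clear => s01 u01 v01; apply/andP; split; nra.
case=> s s01 ->; split; rewrite /=; apply: conv => //; exact: ends.
Qed.

Lemma in_square_inj i j x : in_square i x -> in_square j x -> i = j.
Proof.
have aux (k l : nat) (y : R) : (m * k).+1%:R <= y <= (m * k + m)%:R -> (m * l).+1%:R <= y <= (m * l + m)%:R -> k = l.
  move=> /andP[k1 k2] /andP[l1 l2].
  have := le_trans k1 l2; have := le_trans l1 k2; rewrite !ler_nat -![(_ * _ + m)%N]mulnSr.
  move=> h1 h2; apply/eqP; rewrite eqn_leq.
  by move: h1 h2; rewrite !ltn_mul2l !ltnS => /andP[_ ->] /andP[_ ->].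
move=> [xi yi] [xj yj]; apply: val_inj => /=.
by rewrite (divn_eq i d) (divn_eq j d) (aux _ _ _ xi xj) (aux _ _ _ yi yj).
Qed.

Lemma in_block (i : 'I_(d * d)) (a : T) :
  (m * (i %/ d) <= a.1 < m * (i %/ d) + m)%N -> (m * (i %% d) <= a.2 < m * (i %% d) + m)%N ->
  exists p, a = embed i p.
Proof.
move=> a1 a2.
have l1 : (a.1 - m * (i %/ d) < m)%N by move: a1; clear; lia.
have l2 : (a.2 - m * (i %% d) < m)%N by move: a2; clear; lia.
exists (Ordinal l1, Ordinal l2); rewrite [LHS]surjective_pairing.
congr (_, _); apply: val_inj => /=; first by rewrite subnKC //; case/andP: a1.
by rewrite subnKC //; case/andP: a2.
Qed.

Lemma square_point i (a : T) : in_square i (pos a) -> exists p, a = embed i p.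
Proof.
case; rewrite /= !ler_nat => h1 h2; apply: in_block; first by move: h1; clear; lia.
by move: h2; clear; lia.
Qed.

Lemma embed_straight i p q :
    (forall r, ~ open_segment (posB p) (posB q) (posB r)) ->
  forall r, ~ open_segment (pos (embed i p)) (pos (embed i q)) (pos r).
Proof.
move=> st r seg; have [s er] := square_point (segment_in_square seg).
by move: seg; rewrite er !pos_embed open_segment_frame ?det_unit //; apply: st.
Qed.

Lemma embed_meet i p q r s :
  meet (pos (embed i p)) (pos (embed i q)) (pos (embed i r)) (pos (embed i s)) ->
  meet (posB p) (posB q) (posB r) (posB s).
Proof. by rewrite !pos_embed meet_frame ?det_unit. Qed.

Definition block (i : 'I_(d * d)) : {set T} := [set embed i p | p : B].

(** A standard edge stays between consecutive grid lines, and the sides of a block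
    are grid lines. *)
Lemma standard_in_square i a b x : vec a b \in [:: (1, 0); (0, 1); (1, 1)] ->
  open_segment (pos a) (pos b) x -> in_square i x -> [set a; b] \subset block i.
Proof.
move=> ab [s s01 xE].
have aux (k : nat) (u v : 'I_n) : v%:Z - u%:Z = 0 \/ v%:Z - u%:Z = 1 ->
    (m * k).+1%:R <= (1 - s) * u.+1%:R + s * v.+1%:R <= (m * k + m)%:R ->
    (m * k <= u < m * k + m)%N /\ (m * k <= v < m * k + m)%N.
  case=> uv.
    have -> : nat_of_ord v = u by move: uv; clear; lia.
    rewrite (_ : (1 - s) * _ + _ = u.+1%:R); last by ring.
    by rewrite !ler_nat ltnS.
  have -> : nat_of_ord v = u.+1 by move: uv; clear; lia.
  rewrite (_ : (1 - s) * _ + _ = u.+1%:R + s); last by rewrite -[u.+2%:R]natr1; ring.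
  move=> /andP[h1 h2].
  have : (m * k).+1%:R < u.+2%:R :> R by rewrite -[u.+2%:R]natr1; move: h1 s01; clear; lra.
  have : u.+1%:R < (m * k + m)%:R :> R by move: h2 s01; clear; lra.
  by rewrite !ltr_nat; clear; lia.
have ends : (b.1%:Z - a.1%:Z = 0 \/ b.1%:Z - a.1%:Z = 1) /\ (b.2%:Z - a.2%:Z = 0 \/ b.2%:Z - a.2%:Z = 1).
  by move: ab; rewrite !inE /vec => /or3P[]/eqP[-> ->]; split; by [left|right].
rewrite xE => -[/= x1 x2].
have [a1 b1] := aux _ _ _ ends.1 x1; have [a2 b2] := aux _ _ _ ends.2 x2.
have [p ->] := in_block a1 a2; have [q ->] := in_block b1 b2.
by apply/subsetP => z; rewrite !inE => /orP[]/eqP->; apply: imset_f.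
Qed.

Definition filling : {set {set T}} :=
  [set e in standard_edges n | [forall i, ~~ (e \subset block i)]].

Definition image_edges i (A : {set {set B}}) : {set {set T}} :=
  [set (embed i @: e)%SET | e : {set B} in A].

Definition glue (F : {ffun 'I_(d * d) -> triB}) : {set {set T}} :=
  filling :|: \bigcup_i image_edges i (val (F i)).

Implicit Types F G : {ffun 'I_(d * d) -> triB}.

Lemma embed_injective i : injective (embed i).
Proof. by move=> p q /embed_inj[]. Qed.

Lemma image_block i (e : {set B}) : embed i @: e \subset block i.
Proof. by apply/subsetP => _ /imsetP[p _ ->]; apply: imset_f. Qed.

Lemma glueP F (e : {set T}) : reflect
  (e \in filling \/ exists i (f : {set B}), f \in val (F i) /\ e = embed i @: f) (e \in glue F).
Proof.
rewrite /glue in_setU; apply: (iffP orP) => -[efill|eb]; [by left| |by left|].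
  by case/bigcupP: eb => i _ /imsetP[f fF ->]; right; exists i, f.
by case: eb => i [f [fF ->]]; right; apply/bigcupP; exists i => //; apply: imset_f.
Qed.

Lemma edge_nonempty (X : triB) (f : {set B}) : f \in val X ->
  exists p q, [/\ f = [set p; q], p != q & forall r, ~ open_segment (posB p) (posB q) (posB r)].
Proof.
have /maxsetP[/noncrossingP[st _] _] := triangulationP X.
by move=> /st /straight_edgeP[a [b [-> ab stab]]]; exists a, b.
Qed.

Lemma glue_image F i p q :
  (embed i @: [set p; q] \in glue F) = ([set p; q] \in val (F i)).
Proof.
apply/glueP/idP => [[]|fF]; last by right; exists i, [set p; q].
  rewrite inE => /andP[_ /forallP/(_ i)]; by rewrite image_block.
case=> j [f [fF e]].
have [r [s [fE rs _]]] := edge_nonempty fF; rewrite fE in fF e.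
move: e; rewrite !imsetU1 !imset_set1 => /set2_eq.
by case=> -[/embed_inj[-> ->]] /embed_inj[_ ->] //; rewrite setUC.
Qed.

Lemma glue_noncrossing F : noncrossing pos (glue F).
Proof.
have /noncrossingP[stD ncD] := standard_noncrossing R n.
have fillD g : g \in filling -> g \in standard_edges n by rewrite inE => /andP[].
have edgeE i f : f \in val (F i) -> exists p q, [/\ embed i @: f = [set embed i p; embed i q],
   f = [set p; q], p != q & forall r, ~ open_segment (posB p) (posB q) (posB r)].
  by move=> /edge_nonempty[p [q [-> pq st]]]; exists p, q; rewrite imsetU1 imset_set1.
have fill_block e i f : e \in filling -> f \in val (F i) -> ~ crossing pos e (embed i @: f).
  rewrite inE => /andP[/standard_edgesP[a [b [ab ->]]] /forallP/(_ i)/negP nb] /edgeE[p [q [-> _ _ _]]].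
  move=> /crossing_set2[_ [x [xab xpq]]]; apply: nb.
  exact: standard_in_square ab xab (segment_in_square xpq).
apply/noncrossingP; split=> [e|e f].
  case/glueP=> [|[i [f [/edgeE[p [q [-> _ pq st]]] ->]]]].
    by rewrite inE => /andP[/stD].
  apply/straight_edgeP; exists (embed i p), (embed i q); split=> //.
    by apply: contra_neq pq => /embed_inj[].
  exact: embed_straight.
case/glueP=> [eF|[i [e0 [eF ->]]]] /glueP[fF|[j [f0 [fF ->]]]].
- by apply: ncD; apply: fillD.
- exact: fill_block.
- by rewrite crossingC; apply: fill_block.
have [p [q [eE e0E pq _]]] := edgeE _ _ eF; have [r [s [fE f0E rs _]]] := edgeE _ _ fF.
rewrite eE fE => /crossing_set2[ne [x [xpq xrs]]].
have ij := in_square_inj (segment_in_square xpq) (segment_in_square xrs); subst j.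
have /maxsetP[/noncrossingP[_ nc] _] := triangulationP (F i).
apply: (nc _ _ eF fF); rewrite e0E f0E; apply/crossing_set2; split.
  by apply: contra_neq ne => ef; rewrite -eE -fE e0E f0E ef.
by apply: (@embed_meet i); exists x.
Qed.

Lemma card_glue F : #|glue F| = (#|filling| + \sum_(i < d * d) #|val (F i)|)%N.
Proof.
have disj i j : i != j -> [disjoint image_edges i (val (F i)) & image_edges j (val (F j))].
  move=> ij; apply/pred0P => e /=; apply/andP => -[/imsetP[f fF ->] /imsetP[g gF]].
  have [p [q [-> _ _]]] := edge_nonempty fF; have [r [s [-> _ _]]] := edge_nonempty gF.
  rewrite !imsetU1 !imset_set1 => /set2_eq.
  by case=> -[/embed_inj[e0 _] _]; rewrite e0 eqxx in ij.
have -> : \sum_(i < d * d) #|val (F i)| = #|\bigcup_i image_edges i (val (F i))|.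
  rewrite -sum1_card partition_disjoint_bigcup //; apply: eq_bigr => i _.
  by rewrite sum1_card card_imset //; apply: imset_inj; apply: embed_injective.
rewrite /glue cardsU (_ : _ :&: _ = set0) ?cards0 ?subn0 //.
apply/setP => e; rewrite inE in_set0; apply/negP => /andP[efill /bigcupP[i _ /imsetP[f _ ef]]].
by move: efill; rewrite inE => /andP[_ /forallP/(_ i)]; rewrite ef image_block.
Qed.

Lemma glue_standard : glue [ffun=> standard_triangulation R m] = standard_edges n.
Proof.
apply/setP => e; apply/glueP/idP => [[|[i [f []]]]|eD].
- by rewrite inE => /andP[].
- rewrite ffunE => /standard_edgesP[p [q [pq ->]]] ->; rewrite imsetU1 imset_set1.
  by apply/standard_edgesP; exists (embed i p), (embed i q); rewrite vec_embed.
have [|nf] := boolP (e \in filling); first by left.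
right; move: nf; rewrite inE eD /= negb_forall => /existsP[i]; rewrite negbK => ei.
have /standard_edgesP[a [b [ab eE]]] := eD.
have [p _ ap] : exists2 p, p \in [set: B] & a = embed i p.
  by have /imsetP[p _ ->] : a \in block i by [apply: (subsetP ei); rewrite eE !inE eqxx]; exists p.
have [q _ bq] : exists2 q, q \in [set: B] & b = embed i q.
  by have /imsetP[q _ ->] : b \in block i by [apply: (subsetP ei); rewrite eE !inE eqxx orbT]; exists q.
exists i, [set p; q]; rewrite ffunE imsetU1 imset_set1 -ap -bq; split=> //.
by apply/standard_edgesP; exists p, q; rewrite -(vec_embed i) -ap -bq.
Qed.

(** A glued triangulation has as many edges as the standard one, because the
    triangulations of a block all have the same number of edges. *)
Lemma glue_maximal F : maxset (noncrossing pos) (glue F).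
Proof.
apply: maximal_of_card; first exact: glue_noncrossing.
rewrite -glue_standard !card_glue; congr (_ + _)%N; apply: eq_bigr => i _.
by rewrite ffunE !card_triangulation.
Qed.

Definition glue_tri F : tri := Sub (glue F) (glue_maximal F).

Lemma glue_tri_inj : injective glue_tri.
Proof.
move=> F G /(congr1 val) /= e; apply/ffunP => i; apply: val_inj; apply/setP => f.
suff main (F' G' : {ffun 'I_(d * d) -> triB}) : glue F' = glue G' -> f \in val (F' i) -> f \in val (G' i).
  by apply/idP/idP; apply: main.
move=> e' fF; have [p [q [fE _ _]]] := edge_nonempty fF.
by rewrite fE -glue_image -e' glue_image -fE.
Qed.

Lemma glue_setD (F G : {ffun 'I_(d * d) -> triB}) i :
  (forall j, j != i -> F j = G j) ->
  glue F :\: glue G = image_edges i (val (F i) :\: val (G i)).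
Proof.
move=> FG; apply/setP => e; rewrite inE; apply/andP/imsetP.
  case=> eG /glueP[efill|[j [f [fF ef]]]].
    by case/negP: eG; apply/glueP; left.
  have [p [q [fE _ _]]] := edge_nonempty fF.
  have [ji|ji] := eqVneq j i; last first.
    by case/negP: eG; apply/glueP; right; exists j, f; rewrite -FG.
  subst j; exists f => //; rewrite inE fF andbT.
  by move: eG; rewrite ef fE glue_image.
case=> f; rewrite inE => /andP[fG fF ->]; have [p [q [fE _ _]]] := edge_nonempty fF.
by rewrite fE !glue_image -fE.
Qed.

Lemma glue_hom F G : power_adj (@lattice_flip R m) F G -> lattice_flip (glue_tri F) (glue_tri G).
Proof.
case/existsP=> i /andP[/andP[f1 f2] /forallP eqj].
have FG j : j != i -> F j = G j by move=> ji; have /implyP/(_ ji)/eqP := eqj j.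
have GF j : j != i -> G j = F j by move=> ji; rewrite FG.
rewrite /lattice_flip /flip /= (glue_setD FG) (glue_setD GF).
by rewrite !card_imset ?f1 ?f2 //; apply: imset_inj; apply: embed_injective.
Qed.

End Blocks.

(** * Asymptotics *)

Section Asymptotics.
Variable R : realType.
Local Notation N n := #|lattice_triangulation R n|.
Local Notation tw n := (treewidth (@lattice_flip R n)).

Lemma treewidth_blocks (m d n : nat) : (0 < d)%N -> (d * m <= n)%N ->
  (N m ^ (d * d) <= 2 * (d * d) * N m * (tw n).+1)%N.
Proof.
move=> d0 fits; have dd0 : (0 < d * d)%N by rewrite muln_gt0 d0.
apply: leq_trans (treewidth_power dd0 (@lattice_flip_connected R m)) _.
rewrite leq_mul2l ltnS; apply/orP; right.
exact: treewidth_hom (@glue_tri_inj R m d n fits) (@glue_hom R m d n fits).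
Qed.

(** An antidiagonal of a unit square extends to a nonstandard triangulation. *)
Lemma card_triangulations_ge2 (n : nat) : (1 < n)%N -> (2 <= N n)%N.
Proof.
move=> n1; have n0 := ltnW n1.
pose a : 'I_n * 'I_n := (Ordinal n0, Ordinal n1); pose b : 'I_n * 'I_n := (Ordinal n1, Ordinal n0).
pose c : 'I_n * 'I_n := (Ordinal n0, Ordinal n0).
have vab : vec a b = (1, -1) by [].
have st : straight_edge (@lattice_pos R n) [set a; b].
  by apply: (@unimodular_straight R n a b c); rewrite vab.
have nc1 : noncrossing (@lattice_pos R n) [set [set a; b]].
  apply/noncrossingP; split=> [e|e f]; rewrite !inE; first by move/eqP->.
  by move=> /eqP-> /eqP->; rewrite /crossing eqxx.
have [A maxA abA] := maxset_exists nc1.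
pose X : lattice_triangulation R n := Sub A maxA.
have neq : X != standard_triangulation R n.
  apply/eqP => /(congr1 val) /= AD; rewrite AD in abA.
  have /standard_edgesP[x [y [xy e]]] : [set a; b] \in standard_edges n by apply: (subsetP abA); rewrite inE.
  move: xy; case: (set2_eq e) => -[<- <-]; first by rewrite vab.
  by rewrite (_ : vec b a = (-1, 1)).
have <- : #|[set X; standard_triangulation R n]| = 2%N by rewrite cards2 neq.
exact: max_card.
Qed.

(** Entropy is at most of order [n ^ 2]; its supremum [L] per unit of area is finite
    and positive, and this is what makes the loss from cutting the square into
    blocks of a fixed size arbitrarily small. *)
Definition entropy (n : nat) : R := ln (N n)%:R.

Lemma triangulations_gt0 n : (0 < N n)%N.
Proof. by apply/card_gt0P; exists (standard_triangulation R n). Qed.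

Lemma ln2_le1 : ln 2 <= 1 :> R.
Proof. by have := @le_ln1Dx R 1; rewrite -[1 + 1]/(2%:R); apply; lra. Qed.

Lemma entropy_le (n : nat) : entropy n <= 4 * n%:R ^+ 2.
Proof.
apply: (@le_trans _ _ (ln (2 ^+ (4 * n ^ 2)))).
  rewrite ler_ln ?posrE ?ltr0n ?triangulations_gt0 ?exprn_gt0 // -natrX ler_nat.
  apply: leq_trans (card_triangulations_le R n) _.
  by rewrite leq_exp2l // -!mul2n; apply: eq_leq; ring.
rewrite lnXn // -[ln _ *+ _]mulr_natl natrM natrX ler_piMr ?ln2_le1 //.
Qed.

Lemma entropy_gt0 n : (1 < n)%N -> 0 < entropy n.
Proof. by move=> /card_triangulations_ge2 n2; apply: ln_gt0; rewrite ltr1n. Qed.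

Lemma entropy_blocks (m d n : nat) : (0 < d)%N -> (d * m <= n)%N ->
  d%:R ^+ 2 * entropy m <= 2 * d%:R + entropy m + ln (tw n).+1%:R.
Proof.
move=> d0 fits; have := treewidth_blocks d0 fits; rewrite -(ler_nat R).
have dR : 0 < d%:R :> R by rewrite ltr0n.
have NR : 0 < (N m)%:R :> R by rewrite ltr0n triangulations_gt0.
have tR : 0 < (tw n).+1%:R :> R by rewrite ltr0n.
rewrite !natrM natrX => le_pow.
have : ln ((N m)%:R ^+ (d * d)) <= ln (2 * (d%:R * d%:R) * (N m)%:R * (tw n).+1%:R) :> R.
  by rewrite ler_ln ?posrE ?exprn_gt0 ?mulr_gt0.
rewrite lnXn // !lnM ?posrE ?mulr_gt0 //.
rewrite -[ln _ *+ _]mulr_natl natrM -expr2 -/(entropy m) => h.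
apply: (le_trans h); rewrite lerD2r lerD2r.
have lnd : ln d%:R <= d%:R - 1 :> R.
  have := @le_ln1Dx R (d%:R - 1); rewrite (_ : 1 + (d%:R - 1) = d%:R); last by ring.
  apply.
  by move: dR; clear; lra.
by move: lnd ln2_le1; clear; lra.
Qed.

Local Open Scope classical_set_scope.

(** Take [m] with [entropy m] close to [L * m ^ 2] and cut the square into about
    [(n / m) ^ 2] blocks of size [m]: the power of the flip graph of a block has
    nearly [expR (L * n ^ 2)] vertices, and [entropy n <= L * n ^ 2]. *)
Lemma entropy_lower_bound (dl : R) : 0 < dl < 1 ->
  \forall n \near \oo, (1 - dl) * entropy n <= ln (tw n)%:R.
Proof.
move=> dl01.
pose S : set R := [set x | exists2 n : nat, (0 < n)%N & x = entropy n / n%:R ^+ 2]%classic.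
have Sub : ubound S 4.
  move=> _ [n n0 ->]; rewrite ler_pdivrMr ?entropy_le // exprn_gt0 // ltr0n //.
pose L := sup S.
have supS : has_sup S.
  by split; [exists (entropy 1 / 1%:R ^+ 2); exists 1%N|exists 4].
have L_ub n : (0 < n)%N -> entropy n <= L * n%:R ^+ 2.
  move=> n0; rewrite -ler_pdivrMr ?exprn_gt0 ?ltr0n //.
  by apply: sup_upper_bound => //; exists n.
have L0 : 0 < L.
  have := L_ub 2 isT; have := @entropy_gt0 2 isT; move: (entropy 2) => x; clear.
  by rewrite -natrX; lra.
have dL : 0 < dl / 2 * L by rewrite mulr_gt0 ?divr_gt0 //; case/andP: dl01.
have [_ [m m0 ->]] := sup_adherent dL supS; rewrite -/L => mL.
have mR : 0 < m%:R :> R by rewrite ltr0n.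
have m2R : 0 < m%:R ^+ 2 :> R by rewrite exprn_gt0.
have {}mL : (1 - dl / 2) * L * m%:R ^+ 2 < entropy m.
  by move: mL; rewrite ltr_pdivlMr //; congr (_ < _); ring.
near=> n.
have nm : (m <= n)%N by near: n; apply: nbhs_infty_ge.
have n2 : (2 <= n)%N by near: n; apply: nbhs_infty_ge.
have nbig : (2 * L * m%:R + entropy m + 4) / (dl / 2 * L) <= n%:R.
  by near: n; apply: nbhs_infty_ger.
have d0 : (0 < n %/ m)%N by rewrite divn_gt0.
have fits : (n %/ m * m <= n)%N by apply: leq_trunc_div.
have := entropy_blocks d0 fits; set d := (n %/ m)%N in d0 fits *.
have dm : n%:R - m%:R <= d%:R * m%:R :> R.
  rewrite lerBlDr -natrM -natrD ler_nat {1}(divn_eq n m) leq_add2l ltnW // ltn_mod //.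
have dn : d%:R <= n%:R :> R by rewrite ler_nat leq_div.
move=> hb.
have nmR : 0 <= n%:R - m%:R :> R by rewrite subr_ge0 ler_nat.
have step1 : (1 - dl / 2) * L * (n%:R - m%:R) ^+ 2 <= d%:R ^+ 2 * entropy m.
  apply: (@le_trans _ _ ((1 - dl / 2) * L * (d%:R * m%:R) ^+ 2)).
    rewrite ler_wpM2l ?ler_sqr ?nnegrE ?mulr_ge0 //; last exact: ltW.
    by move: dl01; clear; lra.
  rewrite exprMn mulrCA ler_wpM2l ?exprn_ge0 ?ler0n //; exact: ltW.
have step2 : (1 - dl) * L * n%:R ^+ 2 + 2 * n%:R <= ln (tw n).+1%:R.
  have n1 : 1 <= n%:R :> R by rewrite (ler_nat R 1) ltnW.
  have big : (2 * L * m%:R + entropy m + 4) * n%:R <= dl / 2 * L * n%:R * n%:R.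
    rewrite ler_wpM2r //; by rewrite ler_pdivrMr // in nbig; rewrite [leRHS]mulrC.
  have am : entropy m <= entropy m * n%:R by rewrite ler_peMr // ln_ge0 // ler1n triangulations_gt0.
  have cross : (1 - dl / 2) * L * (n%:R - m%:R) ^+ 2 =
     (1 - dl) * L * n%:R ^+ 2 + dl / 2 * L * n%:R * n%:R - 2 * L * m%:R * n%:R
     + dl * L * m%:R * n%:R + (1 - dl / 2) * L * m%:R ^+ 2 by field.
  have p1 : 0 <= dl * L * m%:R * n%:R by rewrite !mulr_ge0 // ltW //; case/andP: dl01.
  have p2 : 0 <= (1 - dl / 2) * L * m%:R ^+ 2.
    by rewrite !mulr_ge0 ?exprn_ge0 // ?(ltW L0) //; move: dl01; clear; lra.
  by move: hb step1 big am cross p1 p2 dn; clear; lra.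
have main0 : 0 < (1 - dl) * L * n%:R ^+ 2 + 2 * n%:R.
  rewrite ltr_wpDl ?mulr_gt0 ?ltr0n ?(ltnW n2) // !mulr_ge0 ?exprn_ge0 ?(ltW L0) //.
  by move: dl01; clear; lra.
have twn : (0 < tw n)%N.
  by rewrite lt0n; apply/eqP => t0; move: step2; rewrite t0 ln1 leNgt main0.
have : ln (tw n).+1%:R <= ln 2 + ln (tw n)%:R :> R.
  rewrite -lnM ?posrE ?ltr0n // ler_ln ?posrE ?mulr_gt0 ?ltr0n // -natrM ler_nat.
  by move: twn; clear; lia.
have an : (1 - dl) * entropy n <= (1 - dl) * L * n%:R ^+ 2.
  by rewrite -mulrA ler_wpM2l ?L_ub ?(ltnW n2) //; move: dl01; clear; lra.
have nR2 : 2 <= n%:R :> R by rewrite ler_nat.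
by move: step2 an nR2 ln2_le1; clear; lra.
Unshelve. all: by end_near.
Qed.

End Asymptotics.

Local Open Scope classical_set_scope.


Theorem theorem4 (R : realType) :
  exists (c : R) (eps : nat -> R),
    [/\ 0 < c,
        eps n @[n --> \oo] --> (0 : R)
      & \forall n \near \oo,
          c * #|lattice_triangulation R n|%:R `^ (1 - eps n)
            <= (treewidth (@lattice_flip R n))%:R].
Proof.
(* The exponent is the exact one, cut off at 1 because the treewidth is not
   compared with the number of vertices. *)
pose a := @entropy R.
pose w n : R := ln (treewidth (@lattice_flip R n))%:R.
exists 1, (fun n => Num.max 0 (1 - w n / a n)); split=> //.
  apply/cvgr0Pnorm_le => dl dl0.
  have d01 : 0 < Num.min dl (1 / 2) < 1 by rewrite lt_min dl0 gt_min; lra.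
  near=> n.
  have a0 : 0 < a n by apply: entropy_gt0; near: n; apply: nbhs_infty_ge.
  have low : (1 - Num.min dl (1 / 2)) * a n <= w n.
    by near: n; apply: entropy_lower_bound.
  have le_dl : 1 - w n / a n <= dl.
    have : 1 - Num.min dl (1 / 2) <= w n / a n by rewrite ler_pdivlMr.
    have : Num.min dl (1 / 2) <= dl by rewrite ge_min lexx.
    by move: (Num.min _ _) => z; clear; lra.
  by rewrite ger0_norm ?le_max ?lexx // ge_max (ltW dl0).
have h01 : 0 < (1 / 2 : R) < 1 by lra.
near=> n.
have a0 : 0 < a n by apply: entropy_gt0; near: n; apply: nbhs_infty_ge.
have low : (1 - 1 / 2) * a n <= w n by near: n; exact: (entropy_lower_bound h01).
have w0 : 0 < w n by move: a0 low; clear; lra.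
have tw0 : (0 < treewidth (@lattice_flip R n))%N.
  by rewrite lt0n; apply/eqP => t0; move: w0; rewrite /w t0 ln0 // ltxx.
rewrite mul1r.
apply: (@le_trans _ _ (#|lattice_triangulation R n|%:R `^ (w n / a n))).
  apply: ler_powR; first by rewrite ler1n triangulations_gt0.
  have : 1 - w n / a n <= Num.max 0 (1 - w n / a n) by rewrite le_max lexx orbT.
  by move: (Num.max _ _) => z; clear; lra.
rewrite /powR pnatr_eq0 gtn_eqF ?triangulations_gt0 //.
rewrite -/(a n) divfK ?gt_eqF // /w lnK // posrE ltr0n //.
Unshelve. all: by end_near.
Qed.
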